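(* Let $(\mathcal X_t,Q_t,\pi_t)_{t\in[0,T]}$ be a singular time-dependent Markov triple with partition $0=t_0<t_1<\dots<t_n=T$, intervals $I_i=(t_i,t_{i+1})$, vertex sets $\mathcal X_t=\mathcal X_i$ for $t\in I_i$ and $\mathcal X_{t_i}=\bar{\mathcal X}_i$, and spawning and collapsing maps $s_i:\mathcal X_i\to\bar{\mathcal X}_i$, $c_i:\mathcal X_i\to\bar{\mathcal X}_{i+1}$. (a) Heat equation. For every $s\in[0,T]$ and every $\bar\psi\in\mathbb R^{\mathcal X_s}$ there exists a unique function $\psi:\mathcal S_{s,T}\to\mathbb R$ such that: (i) $\psi(s,\cdot)=\bar\psi$ (and, if $s\in I_i$ for some $i$, $t\mapsto\psi(t,\cdot)$ is continuous at $s$ from the right); (ii) for each $i$, $t\mapsto\psi(t,\cdot)$ is differentiable on $I_i\cap(s,T)$ and $\partial_t\psi(t,x)=\Delta_t\psi(t,x)$ for $t\in I_i\cap (s,T)$, $x\in\mathcal X_i$; (iii) for all $i$ with $t_i\in[s,T]$ and all $z\in\bar{\mathcal X}_i$: if $t_i<T$ then $\psi(t_i,z)=\lim_{t\downarrow t_i}\psi(t,x)$ for every $x\in s_i^{-1}(z)$, and if $t_i>s$ then $\psi(t_i,z)=\lim_{t\uparrow t_i}\psi(t,y)$ for every $y\in c_{i-1}^{-1}(z)$. (b) Dual heat equation. For every $t\in[0,T]$ and every $\bar\sigma\in\mathbb R^{\mathcal X_t}$ there exists a unique function $\sigma:\mathcal S_{0,t}\to\mathbb R$ such that: (i) $\sigma(t,\cdot)=\bar\sigma$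 (and, if $t\in I_i$ for some $i$, $r\mapsto\sigma(r,\cdot)$ is continuous at $t$ from the left); (ii) for each $i$, $r\mapsto\sigma(r,\cdot)$ is differentiable on $I_i\cap(0,t)$ and $\partial_r\sigma(r,x)=-\hat\Delta_r\sigma(r,x)$ for $r\in I_i\cap(0,t)$, $x\in\mathcal X_i$; (iii) for all $i$ with $t_i\in[0,t]$ and all $z\in\bar{\mathcal X}_i$: if $t_i<t$ then $\sigma(t_i,z)=\sum_{x\in s_i^{-1}(z)}\lim_{r\downarrow t_i}\sigma(r,x)$, and if $t_i>0$ then $\sigma(t_i,z)=\sum_{y\in c_{i-1}^{-1}(z)}\lim_{r\uparrow t_i}\sigma(r,y)$ (in particular these limits exist).
   Context: A Markov triple $(\mathcal X,Q,\pi)$ consists of a finite set $\mathcal X$, a matrix of transition rates $Q:\mathcal X\times\mathcal X\to\mathbb R$ with $Q(x,y)\ge0$ for $x\ne y$ and $Q(x,x)=-\sum_{y\neq x}Q(x,y)$, which is irreducible (any two points are joined by a path along which $Q>0$), and a strictly positive probability measure $\pi$ on $\mathcal X$ with $Q(x,y)\pi(x)=Q(y,x)\pi(y)$ for all $x,y$. A singular time-dependent Markov triple is a family $(\mathcal X_t,Q_t,\pi_t)_{t\in[0,T]}$ of Markov triples such that there exist a partition $0=t_0<t_1<\dots<t_n=T$, finite sets $\bar{\mathcal X}_0,\dots,\bar{\mathcal X}_n$ and $\mathcal X_0,\dots,\mathcal X_{n-1}$, and surjective maps $s_i:\mathcal X_i\to\bar{\mathcal X}_i$, $c_i:\mathcal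 X_i\to\bar{\mathcal X}_{i+1}$ ($i=0,\dots,n-1$) with: (1) $\mathcal X_{t_i}=\bar{\mathcal X}_i$, and $\mathcal X_t=\mathcal X_i$ for $t\in I_i:=(t_i,t_{i+1})$. (2) For all $i$ and $x\in\mathcal X_i$, $t\mapsto\pi_t(x)$ is Lipschitz on $I_i$ and the limits $\pi_i^c(x)=\lim_{t\uparrow t_{i+1}}\pi_t(x)$, $\pi_i^s(x)=\lim_{t\downarrow t_i}\pi_t(x)$ exist in $(0,1)$. (3) For all $x\neq y$ in $\mathcal X_i$, either $Q_t(x,y)=0$ for all $t\in I_i$, or $Q_t(x,y)>0$ for all $t\in I_i$ and $t\mapsto\log Q_t(x,y)$ is locally Lipschitz on $I_i$; the limits $Q_i^c(x,y)=\lim_{t\uparrow t_{i+1}}Q_t(x,y)$ and $Q_i^s(x,y)=\lim_{t\downarrow t_i}Q_t(x,y)$ exist in $[0,\infty]$; if $Q_i^c(x,y)=+\infty$ then $\int^{t_{i+1}}Q_t(x,y)\,dt=+\infty$, and if $Q_i^s(x,y)=+\infty$ then $\int_{t_i}Q_t(x,y)\,dt=+\infty$ (integrals over one-sided neighbourhoods in $I_i$). (4) For $x,y\in\mathcal X_i$: $c_i(x)=c_i(y)$ iff $x$ and $y$ are joined by a (possibly trivial) path in $\mathcal X_i$ along each edge of which $Q_i^c=+\infty$; and $s_i(x)=s_i(y)$ iff they are joined by a path along each edge of which $Q_i^s=+\infty$. (5) For $z\in\bar{\mathcal X}_i$: $\pi_{t_i}(z)=\sum_{x\in s_i^{-1}(z)}\pi_i^s(x)=\sum_{x\in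 c_{i-1}^{-1}(z)}\pi_{i-1}^c(x)$, and for $z\ne z'$ in $\bar{\mathcal X}_i$: $Q_{t_i}(z,z')=\frac1{\pi_{t_i}(z)}\sum_{x\in s_i^{-1}(z),x'\in s_i^{-1}(z')}Q_i^s(x,x')\pi_i^s(x)=\frac1{\pi_{t_i}(z)}\sum_{x\in c_{i-1}^{-1}(z),x'\in c_{i-1}^{-1}(z')}Q_{i-1}^c(x,x')\pi_{i-1}^c(x)$ (at $i=0$ only the expressions with $s_i$, at $i=n$ only those with $c_{i-1}$, are required). For $\psi,\sigma\in\mathbb R^{\mathcal X_t}$: $\Delta_t\psi(x)=\sum_{y\in\mathcal X_t}[\psi(y)-\psi(x)]Q_t(x,y)$ and $\hat\Delta_t\sigma(x)=\sum_{y\neq x}[Q_t(y,x)\sigma(y)-Q_t(x,y)\sigma(x)]$. For $0\le s\le t\le T$, space-time is $\mathcal S_{s,t}=\{(r,x): r\in[s,t],\ x\in\mathcal X_r\}$. *)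

(* Defs.v *)
From HB Require Import structures.
From mathcomp Require Import all_boot all_order all_algebra.
From mathcomp Require Import all_classical all_reals all_analysis.

Set Implicit Arguments.
Unset Strict Implicit.
Unset Printing Implicit Defensive.

Import Order.TTheory GRing.Theory Num.Theory.
Import numFieldNormedType.Exports.

Local Open Scope classical_set_scope.
Local Open Scope ring_scope.

Section MarkovTriple.
Context {R : realType} {X : finType}.
Implicit Types (Q : X -> X -> R) (pi : X -> R).

Definition irreducible_rates Q : Prop :=
  forall x y, connect [rel x y | 0 < Q x y] x y.

Record markov_triple Q pi : Prop := MarkovTriple {
  rate_ge0 : forall x y, x != y -> 0 <= Q x y;
  rate_diag : forall x, Q x x = - \sum_(y | y != x) Q x y;
  rate_irreducible : irreducible_rates Q;
  prob_gt0 : forall x, 0 < pi x;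
  prob_sum1 : \sum_x pi x = 1;
  detailed_balance : forall x y, Q x y * pi x = Q y x * pi y }.

Definition laplacian Q (psi : X -> R) (x : X) : R :=
  \sum_y (psi y - psi x) * Q x y.

Definition dual_laplacian Q (sigma : X -> R) (x : X) : R :=
  \sum_(y | y != x) (Q y x * sigma y - Q x y * sigma x).

End MarkovTriple.

(* Families indexed by [nat] are meaningful only for indices [i < nsteps]
   (for [st], [rate], [prob], [spawn], [collapse] and the limits), respectively
   [i <= nsteps] (for [knot], [kst], [krate], [kprob]), and [rate i], [prob i] only
   at times in the open interval ]knot i, knot i.+1[; nothing is assumed about
   the other values.

   The family (X_t, Q_t, pi_t) is given by (kst i, krate i, kprob i) at
   t = knot i and by (st i, rate i t, prob i t) for knot i < t < knot i.+1.

   The conditions at the right end of an interval are indexed by that interval: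
   the pair (t_i, c_(i-1)) of the mathematical text is (knot j.+1, collapse j).

   The limits of the rates are extended reals; their values on the diagonal
   play no role. *)
Record singular_markov_triple (R : realType) (T : R) := SingularMarkovTriple {
  nsteps : nat;
  knot : nat -> R;
  kst : nat -> finType;
  st : nat -> finType;
  spawn : forall i, st i -> kst i;
  collapse : forall i, st i -> kst i.+1;
  krate : forall i, kst i -> kst i -> R;
  kprob : forall i, kst i -> R;
  rate : forall i, R -> st i -> st i -> R;
  prob : forall i, R -> st i -> R;
  prob_s : forall i, st i -> R;
  prob_c : forall i, st i -> R;
  rate_s : forall i, st i -> st i -> \bar R;
  rate_c : forall i, st i -> st i -> \bar R;

  nsteps_gt0 : (0 < nsteps)%N;
  knot0 : knot 0%N = 0;
  knotT : knot nsteps = T;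
  knot_lt : forall i, (i < nsteps)%N -> knot i < knot i.+1;
  spawn_surj : forall i, (i < nsteps)%N ->
    forall z, exists x, @spawn i x = z;
  collapse_surj : forall i, (i < nsteps)%N ->
    forall z, exists x, @collapse i x = z;

  knot_markov : forall i, (i <= nsteps)%N -> markov_triple (@krate i) (@kprob i);
  inner_markov : forall i t, (i < nsteps)%N -> knot i < t < knot i.+1 ->
    markov_triple (@rate i t) (@prob i t);

  prob_lipschitz : forall i (x : st i), (i < nsteps)%N ->
    [lipschitz (prob t x) | t in `]knot i, knot i.+1[%classic];
  prob_c_lim : forall i (x : st i), (i < nsteps)%N ->
    prob t x @[t --> (knot i.+1)^'-] --> prob_c x /\ 0 < prob_c x < 1;
  prob_s_lim : forall i (x : st i), (i < nsteps)%N ->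
    prob t x @[t --> (knot i)^'+] --> prob_s x /\ 0 < prob_s x < 1;

  rate_regular : forall i (x y : st i), (i < nsteps)%N -> x != y ->
    (forall t, knot i < t < knot i.+1 -> rate t x y = 0) \/
    ((forall t, knot i < t < knot i.+1 -> 0 < rate t x y) /\
     [locally [lipschitz (ln (rate t x y)) |
                 t in `]knot i, knot i.+1[%classic]]);
  rate_c_lim : forall i (x y : st i), (i < nsteps)%N -> x != y ->
    (rate t x y)%:E @[t --> (knot i.+1)^'-] --> rate_c x y /\
    (0 <= rate_c x y)%E;
  rate_s_lim : forall i (x y : st i), (i < nsteps)%N -> x != y ->
    (rate t x y)%:E @[t --> (knot i)^'+] --> rate_s x y /\
    (0 <= rate_s x y)%E;
  rate_c_int : forall i (x y : st i), (i < nsteps)%N -> x != y ->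
    rate_c x y = +oo%E -> forall a, knot i < a < knot i.+1 ->
    (\int[@lebesgue_measure R]_(t in `]a, knot i.+1[) (rate t x y)%:E = +oo)%E;
  rate_s_int : forall i (x y : st i), (i < nsteps)%N -> x != y ->
    rate_s x y = +oo%E -> forall a, knot i < a < knot i.+1 ->
    (\int[@lebesgue_measure R]_(t in `]knot i, a[) (rate t x y)%:E = +oo)%E;

  collapse_eq : forall i (x y : st i), (i < nsteps)%N ->
    collapse x = collapse y <->
    connect [rel u v | (u != v) && (rate_c u v == +oo%E)] x y;
  spawn_eq : forall i (x y : st i), (i < nsteps)%N ->
    spawn x = spawn y <->
    connect [rel u v | (u != v) && (rate_s u v == +oo%E)] x y;

  kprob_s : forall i (z : kst i), (i < nsteps)%N ->
    kprob z = \sum_(x | spawn x == z) prob_s x;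
  kprob_c : forall i (z : kst i.+1), (i < nsteps)%N ->
    kprob z = \sum_(x | collapse x == z) prob_c x;
  krate_s : forall i (z z' : kst i), (i < nsteps)%N -> z != z' ->
    ((krate z z')%:E = ((kprob z)^-1)%:E *
      \sum_(x | spawn x == z) \sum_(x' | spawn x' == z')
        (rate_s x x' * (prob_s x)%:E))%E;
  krate_c : forall i (z z' : kst i.+1), (i < nsteps)%N -> z != z' ->
    ((krate z z')%:E = ((kprob z)^-1)%:E *
      \sum_(x | collapse x == z) \sum_(x' | collapse x' == z')
        (rate_c x x' * (prob_c x)%:E))%E }.

Arguments nsteps {R T}.
Arguments knot {R T}.
Arguments kst {R T}.
Arguments st {R T}.
Arguments spawn {R T} _ {i}.
Arguments collapse {R T} _ {i}.
Arguments krate {R T} _ {i}.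
Arguments kprob {R T} _ {i}.
Arguments rate {R T} _ {i}.
Arguments prob {R T} _ {i}.
Arguments prob_s {R T} _ {i}.
Arguments prob_c {R T} _ {i}.
Arguments rate_s {R T} _ {i}.
Arguments rate_c {R T} _ {i}.

Section SpaceTime.
Context {R : realType} {T : R} (M : singular_markov_triple T).

(* [at_knot z] is the point (knot i, z), and [inner t x] is the point (t, x)
   over the i-th open interval; [spacetime] keeps the points whose index and
   time are admissible. *)
Variant st_point : Type :=
| at_knot (i : nat) of kst M i
| inner (i : nat) of R & st M i.

Definition spacetime (s t : R) : set st_point := [set p |
  match p with
  | @at_knot i _ => (i <= nsteps M)%N /\ s <= knot M i <= t
  | @inner i r _ => [/\ (i < nsteps M)%N, knot M i < r < knot M i.+1 & s <= r <= t]
  end].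

(* A function on the state space at time [s] is a function on
   [spacetime s s]. Functions on space-time are extended by 0 (['valL_0]) in
   order to be evaluated; only values at points of space-time matter. *)
Definition heat_solution (s : R) (psi0 : spacetime s s -> R)
    (psi : spacetime s T -> R) : Prop :=
  let u : st_point -> R := 'valL_0 psi in
  [/\ (forall p : spacetime s s, u (val p) = psi0 p),
      (forall i (x : st M i), (i < nsteps M)%N -> knot M i < s < knot M i.+1 ->
         u (inner r x) @[r --> s^'+] --> u (inner s x)),
      (forall i (x : st M i) (t : R), (i < nsteps M)%N ->
         knot M i < t < knot M i.+1 -> s < t < T ->
         is_derive t 1 (fun r => u (inner r x))
           (laplacian (rate M t) (fun y => u (inner t y)) x)),
      (forall i (z : kst M i) (x : st M i), (i < nsteps M)%N -> s <= knot M i ->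
         spawn M x = z ->
         u (inner r x) @[r --> (knot M i)^'+] --> u (at_knot z)) &
      (forall i (z : kst M i.+1) (y : st M i), (i < nsteps M)%N ->
         s < knot M i.+1 -> collapse M y = z ->
         u (inner r y) @[r --> (knot M i.+1)^'-] --> u (at_knot z))].

Definition dual_heat_solution (t : R) (sigma0 : spacetime t t -> R)
    (sigma : spacetime 0 t -> R) : Prop :=
  let u : st_point -> R := 'valL_0 sigma in
  [/\ (forall p : spacetime t t, u (val p) = sigma0 p),
      (forall i (x : st M i), (i < nsteps M)%N -> knot M i < t < knot M i.+1 ->
         u (inner r x) @[r --> t^'-] --> u (inner t x)),
      (forall i (x : st M i) (r : R), (i < nsteps M)%N ->
         knot M i < r < knot M i.+1 -> 0 < r < t ->
         is_derive r 1 (fun q => u (inner q x))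
           (- dual_laplacian (rate M r) (fun y => u (inner r y)) x)),
      (forall i (z : kst M i), (i < nsteps M)%N -> knot M i < t ->
         (forall x : st M i, spawn M x = z ->
            cvg (u (inner r x) @[r --> (knot M i)^'+])) /\
         u (at_knot z) = \sum_(x | spawn M x == z)
           lim (u (inner r x) @[r --> (knot M i)^'+])) &
      (forall i (z : kst M i.+1), (i < nsteps M)%N -> knot M i.+1 <= t ->
         (forall y : st M i, collapse M y = z ->
            cvg (u (inner r y) @[r --> (knot M i.+1)^'-])) /\
         u (at_knot z) = \sum_(y | collapse M y == z)
           lim (u (inner r y) @[r --> (knot M i.+1)^'-]))].

End SpaceTime.

Arguments spacetime {R T} M s t _.

(* Main.v *)
Require Import Defs.
From mathcomp Require Import all_boot all_order all_algebra.
From mathcomp Require Import all_classical all_reals all_analysis.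
From mathcomp Require Import measurable_realfun ring lra.

Set Implicit Arguments.
Unset Strict Implicit.
Unset Printing Implicit Defensive.

Import Order.TTheory GRing.Theory Num.Theory.
Import numFieldNormedType.Exports.

Local Open Scope classical_set_scope.
Local Open Scope ring_scope.

(* On one interval the equations are linear, so only the two ends matter.
   Forward from a spawning time, the heat flow is a sup-norm contraction and the
   rates between different clusters stay bounded, so the solution started from a
   cluster-constant function at time a + e moves by O(t - a); letting e tend to 0
   gives existence, and contraction gives uniqueness.
   At a collapsing time, detailed balance makes each energy
   F = sum_x p_t(x) phi(rho_t(x)), phi convex, decreasing up to a Lipschitz
   error, hence convergent. Differences of convex functions then determine the
   limit law of rho_t, which has finite support, and by continuity every
   rho_t(x) converges. For phi(u) = u^2 the dissipation bounds the integral of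
   Q_t(x,y) (rho_t(x) - rho_t(y))^2, so the limits at x and y agree whenever
   Q(x,y) has infinite integral.
   For the dual equation, run time backwards and write sigma = p rho: since p is
   Lipschitz, rho solves the heat equation up to a bounded error and the same
   arguments apply, with the l^1 norm of sigma as the contracted norm. *)

(** * Continuous induction and Dini derivatives *)

Section RealInduction.
Context {R : realType}.
Implicit Types (P : R -> Prop) (f F : R -> R) (a b s t K : R).

(** The rates may be unbounded at both ends of an interval, and at an explosive end the only
    quantitative information on them is a divergent integral, so Gronwall estimates on the
    coefficients are useless there. Every bound that has to survive up to an end rests instead on
    the sign of the rates, on detailed balance, and on the rates between clusters. Moreover [p] is
    merely Lipschitz, so the density of a dual solution need not be differentiable. The estimates
    are therefore stated for right difference quotients, whose step may be chosen short depending on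
    the time and on the rates at that time; continuous induction then turns them into bounds with
    constants independent of the rates inside the clusters. The delicate case is the dual equation
    at a collapsing time, where only the cluster sums of the starting values are prescribed. For
    existence the mass is distributed inside a cluster in proportion to [p]. For uniqueness the
    dissipation bound is used at the starting end: the density of a solution has equal limits on a
    cluster, and a cluster sum equal to 0 then forces these limits to vanish. *)

Lemma near_rightP P t :
  (\forall u \near t^'+, P u) <->
  exists2 d, 0 < d & forall u, t < u < t + d -> P u.
Proof.
split.
  rewrite /at_right near_withinE => /nbhs_ballP[d /= d0 dP].
  exists d => // u /andP[tu utd]; apply: dP => //.
  by rewrite /ball /= ltr_distlC; lra.
move=> [d d0 dP]; rewrite /at_right near_withinE.
apply/nbhs_ballP; exists d => // u /=.
by rewrite /ball /= ltr_distlC => ? ?; apply: dP; lra.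
Qed.

Lemma near_leftP P t :
  (\forall u \near t^'-, P u) <->
  exists2 d, 0 < d & forall u, t - d < u < t -> P u.
Proof.
split.
  rewrite /at_left near_withinE => /nbhs_ballP[d /= d0 dP].
  exists d => // u /andP[tu utd]; apply: dP => //.
  by rewrite /ball /= ltr_distlC; lra.
move=> [d d0 dP]; rewrite /at_left near_withinE.
apply/nbhs_ballP; exists d => // u /=.
by rewrite /ball /= ltr_distlC => ? ?; apply: dP; lra.
Qed.

(** The supremum of the times up to which [P] holds is itself such a time, and it cannot lie before
    [b]. This replaces differential inequalities when only information to the right of each time is
    available. *)
Lemma real_induction P a b : a <= b -> P a ->
  (forall t, a <= t < b -> P t -> \forall u \near t^'+, P u) ->
  (forall t, a < t <= b -> (forall u, a <= u < t -> P u) -> P t) -> P b.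
Proof.
move=> ab Pa Pr Pl.
pose S := [set t | a <= t <= b /\ forall u, a <= u <= t -> P u].
have Sa : S a.
  by split=> [|u]; [lra|move=> ua; have -> : u = a by lra].
have Sub : ubound S b by move=> t [/andP[]].
have hS : has_sup S by split; [exists a | exists b].
have aS : a <= sup S by apply: sup_upper_bound.
have Sb : sup S <= b by apply: sup_le_ub => //; exists a.
have below u : a <= u < sup S -> P u.
  move=> /andP[au uS].
  have [t [_ tP] ut] : exists2 t, S t & sup S - (sup S - u) < t.
    by apply: sup_adherent => //; lra.
  by apply: tP; lra.
have PS : P (sup S).
  have [aS'|] := ltP a (sup S); first by apply: Pl => //; lra.
  by move=> Sa'; have -> : sup S = a by lra.
have [Sb'|bS] := ltP (sup S) b; last by have <- : sup S = b by lra.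
have /near_rightP[d d0 dP] : \forall u \near (sup S)^'+, P u by apply: Pr => //; lra.
pose v := Num.min (sup S + d / 2) b.
have [vd vb] : v <= sup S + d / 2 /\ v <= b by rewrite !ge_min !lexx orbT.
have vS : sup S < v by rewrite lt_min; lra.
suff : S v by move/(sup_upper_bound hS); lra.
split; first lra.
move=> u /andP[au uv]; have [uS|Su] := ltP u (sup S); first by apply: below; lra.
have [Su'|Su'] := ltP (sup S) u; first by apply: dP; lra.
by have -> : u = sup S by lra.
Qed.

Lemma le_left_limit f a t c : {for t, continuous f} -> a < t ->
  (forall u, a <= u < t -> f u <= c) -> f t <= c.
Proof.
move=> ft ta fc; apply: (@cvgr_to_le _ (at_left t) _ _ f) => //.
  exact: cvg_at_left_filter.
by apply/near_leftP; exists (t - a) => [|u ut]; [lra|apply: fc; lra].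
Qed.

(* A one-sided Dini derivative bounded by [K] already bounds increments. *)
Lemma dini_le F a b K :
  (forall t, a < t < b -> {for t, continuous F}) ->
  (forall t, a < t < b -> forall e, 0 < e ->
     \forall u \near t^'+, F u <= F t + (K + e) * (u - t)) ->
  forall s t, a < s -> s <= t -> t < b -> F t <= F s + K * (t - s).
Proof.
move=> Fc Fd s t as_ st tb; apply/ler_addgt0Pr => e e0.
(* The summand 1 keeps the denominator positive when [s = t]; the slack accumulated over the
   interval is at most [e]. *)
pose e' := e / (t - s + 1).
have e'0 : 0 < e' by rewrite divr_gt0//; lra.
suff : F t <= F s + (K + e') * (t - s).
  move=> /le_trans; apply; rewrite mulrDl addrA lerD2l.
  by rewrite /e' mulrAC ler_pdivrMr; nra.
apply: (@real_induction (fun t => F t <= F s + (K + e') * (t - s)) s t) => //.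
- by rewrite subrr mulr0 addr0.
- move=> u su uF; have /Fd/(_ _ e'0) : a < u < b by lra.
  by apply: filterS => v; lra.
- move=> u su uF.
  suff : F u - (K + e') * (u - s) <= F s by lra.
  apply: (@le_left_limit (fun u => F u - (K + e') * (u - s)) s) => //.
  + apply: cvgB; first by apply: Fc; lra.
    apply: cvgM; first exact: cvg_cst.
    by apply: cvgB; [exact: cvg_id|exact: cvg_cst].
  + by lra.
  + by move=> v /uF; lra.
Qed.

End RealInduction.

(** * Limits and primitives on an open interval *)

Lemma cvg_bigsum {R : realType} T (F : set_system T) {FF : Filter F} I (r : seq I)
    (P : pred I) (f : I -> T -> R) (l : I -> R) :
  (forall i, P i -> f i t @[t --> F] --> l i) ->
  \sum_(i <- r | P i) f i t @[t --> F] --> \sum_(i <- r | P i) l i.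
Proof.
move=> fl; elim: r => [|i r IH].
  by under eq_fun do rewrite big_nil; rewrite big_nil; exact: cvg_cst.
under eq_fun do rewrite big_cons; rewrite big_cons.
by case: ifP => // Pi; apply: cvgD => //; exact: fl.
Qed.

Section Primitive.
Context {R : realType}.
Implicit Types (f F g G q : R -> R) (a b s t c C : R).
Notation mu := (@lebesgue_measure R).

Lemma near_oo a b t : a < t < b -> \forall u \near t, a < u < b.
Proof.
move=> tab; near=> u; apply/andP; split.
  by near: u; apply: lt_nbhsr; lra.
by near: u; apply: lt_nbhsl; lra.
Unshelve. all: by end_near. Qed.

Lemma near_right_interval (P : R -> Prop) a b : a < b ->
  (\forall t \near a^'+, P t) ->
  exists2 b', a < b' < b & forall t, a < t < b' -> P t.
Proof.
move=> ab /near_rightP[d d0 dP].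
pose m := Num.min d (b - a).
have [md mt] : m <= d /\ m <= b - a by rewrite !ge_min !lexx orbT.
have m0 : 0 < m by rewrite lt_min; lra.
by exists (a + m / 2) => [|t tb]; [lra|apply: dP; lra].
Qed.

Lemma near_left_interval (P : R -> Prop) a b : a < b ->
  (\forall t \near b^'-, P t) ->
  exists2 a', a < a' < b & forall t, a' < t < b -> P t.
Proof.
move=> ab /near_leftP[d d0 dP].
pose m := Num.min d (b - a).
have [md mt] : m <= d /\ m <= b - a by rewrite !ge_min !lexx orbT.
have m0 : 0 < m by rewrite lt_min; lra.
by exists (b - m / 2) => [|t tb]; [lra|apply: dP; lra].
Qed.

Lemma near_right_oo a b : a < b -> \forall t \near a^'+, a < t < b.
Proof. by move=> ab; apply/near_rightP; exists (b - a) => [|u ?]; lra. Qed.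

Lemma near_left_oo a b : a < b -> \forall t \near b^'-, a < t < b.
Proof. by move=> ab; apply/near_leftP; exists (b - a) => [|u ?]; lra. Qed.

Lemma lipschitz_continuous_oo f a b k : 0 <= k ->
  (forall s t, a < s < b -> a < t < b -> `|f s - f t| <= k * `|s - t|) ->
  forall t, a < t < b -> {for t, continuous f}.
Proof.
move=> k0 fk t tab; apply/cvgrPdist_le => e e0.
have k1 : 0 < k + 1 by lra.
have ek : 0 < e / (k + 1) by rewrite divr_gt0.
near=> u; apply: (le_trans (fk _ _ _ _)) => //; first by near: u; apply: near_oo.
apply: (@le_trans _ _ (k * (e / (k + 1)))).
  rewrite ler_wpM2l//; near: u; exact: (@cvgr_dist_le _ _ _ _ _ id t).
by rewrite mulrA ler_pdivrMr//; nra.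
Unshelve. all: by end_near. Qed.

Lemma is_derive_continuous F t (d : R) : is_derive t 1 F d -> {for t, continuous F}.
Proof. by move=> [dF _]; exact/differentiable_continuous/derivable1_diffP. Qed.

Lemma oo_continuous_within f a b s t :
  (forall u, a < u < b -> {for u, continuous f}) -> a < s -> t < b ->
  {within `[s, t], continuous f}.
Proof.
move=> fc as_ tb; apply: continuous_in_subspaceT => u.
by rewrite inE /= in_itv/= => ?; apply: fc; lra.
Qed.

Lemma is_derive_le_increment F G f g a b :
  (forall t, a < t < b -> is_derive t 1 F (f t)) ->
  (forall t, a < t < b -> is_derive t 1 G (g t)) ->
  forall s t, a < s -> s <= t -> t < b ->
  (forall u, s <= u <= t -> f u <= g u) -> F t - F s <= G t - G s.
Proof.
move=> dF dG s t as_ st tb fg.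
have dGF u : a < u < b -> is_derive u 1 (G - F) (g u - f u).
  by move=> ub; have := dF u ub; have := dG u ub => ? ?; apply: is_deriveB.
have [||u ust E] := @MVT_segment _ (G - F) (g \- f) s t st.
- by move=> u; rewrite in_itv/= => ?; apply: dGF; lra.
- by apply: oo_continuous_within as_ tb => u /dGF/is_derive_continuous.
move: ust; rewrite in_itv /= => ust.
have : 0 <= (g u - f u) * (t - s) by rewrite mulr_ge0// subr_ge0//; exact: fg.
by rewrite -E !fctE; lra.
Qed.

Lemma primitive_from f a b c : a < c ->
  (forall t, a < t < b -> {for t, continuous f}) ->
  exists F, forall t, c < t < b -> is_derive t 1 F (f t).
Proof.
move=> ac fc; exists (fun x => \int[mu]_(u in [set` Interval (BLeft c) (BRight x)]) f u) => t ctb; have ctb' : a < t < b by lra.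
have itf : mu.-integrable `[c, ((t + b) / 2)] (EFin \o f).
  apply: continuous_compact_integrable; first exact: segment_compact.
  by apply: oo_continuous_within fc _ _; lra.
have tu : t < (t + b) / 2 by lra.
have FTC := @continuous_FTC1 R f (BLeft c) t _ tu itf.
have [|dF FE] := FTC _ (fc t ctb'); first by (rewrite /Order.lt/=; lra).
split; first exact: dF.
by rewrite -derive1E; exact: FE.
Qed.

(** Since [f] need not be integrable at either end, no single base point yields a primitive on the
    whole interval. The base point [c t] varies with [t], and [FE] shows that increments do not
    depend on it. *)
Lemma primitive_exists f a b s : a < s < b ->
  (forall t, a < t < b -> {for t, continuous f}) ->
  exists F, F s = 0 /\ forall t, a < t < b -> is_derive t 1 F (f t).
Proof.
move=> sab fc.
have PF c : exists F, a < c -> forall t, c < t < b -> is_derive t 1 F (f t).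
  have [ac|] := boolP (a < c); last by exists (fun=> 0).
  by have [F ?] := primitive_from ac fc; exists F.
have {PF} [F dF] := choice PF.
have FE c c' x y : a < c -> c <= c' -> c' < x -> x <= y -> y < b ->
    F c y - F c x = F c' y - F c' x.
  move=> ac cc' cx xy yb; apply/eqP; rewrite eq_le; apply/andP; split.
  - apply: (@is_derive_le_increment _ _ f f c' b) => // t ?; apply: dF; lra.
  - apply: (@is_derive_le_increment _ _ f f c' b) => // t ?; apply: dF; lra.
pose c t := (a + Num.min s t) / 2.
exists (fun t => F (c t) t - F (c t) s); split; first by rewrite subrr.
move=> t tab.
have mint : a < Num.min s t by rewrite lt_min; lra.
(* One base point that serves all times near [t]: it does not exceed [c u] as soon as [u > c t]. *)
pose d := (a + c t) / 2.
have ct : [/\ a < c t, c t < s, c t < t & a < d < c t].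
  have : Num.min s t <= s /\ Num.min s t <= t by rewrite !ge_min !lexx orbT.
  by rewrite /d /c; split; lra.
case: ct => act cts ctt dct.
have : is_derive t 1 (F d - cst (F d s)) (f t).
  rewrite -[f t]subr0; apply: is_deriveB; apply: dF; lra.
apply: near_eq_is_derive.
have : \forall u \near t, c t < u < b.
  by apply: near_oo; lra.
apply: filterS => u ub; rewrite !fctE.
have mu_ : c t <= Num.min s u by rewrite le_min; lra.
have [dcu cu1 cu2] : [/\ d <= c u, c u < u & c u < s].
  have : Num.min s u <= s /\ Num.min s u <= u by rewrite !ge_min !lexx orbT.
  by rewrite /d {2}/c; split; [lra|rewrite /c; lra..].
have [su|us] := leP s u; first by apply: FE; lra.
suff : F d s - F d u = F (c u) s - F (c u) u by lra.
by apply: FE; lra.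
Qed.

(* For continuous [f >= 0]: the integral of [f] over ]a, b[ is finite. *)
Definition bounded_primitive f a b := exists G C,
  (forall t, a < t < b -> is_derive t 1 G (f t)) /\
  (forall s t, a < s -> s <= t -> t < b -> G t - G s <= C).

(** Monotone convergence along compact subintervals, on each of which the integral is an increment
    of [G]. It links the divergent integrals of the hypotheses to primitives, the only integrals
    used in the estimates. *)
Lemma bounded_primitive_integral q a b : a < b ->
  (forall t, a < t < b -> {for t, continuous q}) ->
  (forall t, a < t < b -> 0 <= q t) -> bounded_primitive q a b ->
  (\int[mu]_(t in `]a, b[) (q t)%:E < +oo)%E.
Proof.
move=> ab qc q0 [G [C [dG GC]]].
pose h := (b - a) / 2.
have h0 : 0 < h by rewrite /h; lra.
(* The shift by 2 gives [e n < h] already for [n = 0], so that no [A n] degenerates. *)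
pose e n : R := h / n.+2%:R.
have e0 n : 0 < e n by rewrite divr_gt0.
have eh n : e n < h by rewrite ltr_pdivrMr// ltr_pMr// ltr1n.
pose A n := `[a + e n, b - e n]%classic.
have eE m n : (m <= n)%N -> e n <= e m.
  by move=> mn; rewrite ler_pM2l// lef_pV2 ?posrE// ler_nat.
have -> : `]a, b[%classic = \bigcup_n A n.
  apply/seteqP; split=> [t|t [n _]]; rewrite /A /= !in_itv/=; last first.
    by have := e0 n; lra.
  move=> tab; pose r := Num.min (t - a) (b - t).
  have r0 : 0 < r by rewrite lt_min; lra.
  have rt : r <= t - a /\ r <= b - t by rewrite !ge_min !lexx orbT.
  exists (Num.truncn (h / r)) => //=; rewrite in_itv/=.
  suff : e (Num.truncn (h / r)) <= r by lra.
  rewrite ler_pdivrMr// mulrC -ler_pdivrMr//.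
  have := truncnS_gt (h / r) => /ltW/le_trans; apply.
  by rewrite ler_nat.
have qcA n : {within A n, continuous q}.
  by apply: oo_continuous_within qc _ _; have := e0 n; lra.
have mA n : measurable_fun (A n) (EFin \o q).
  apply/measurable_EFinP; apply: subspace_continuous_measurable_fun; last exact: qcA.
  exact: measurable_itv.
have Amono : {homo A : n m / (n <= m)%N >-> (n <= m)%O}.
  by move=> m n mn; apply/subsetPset => t; rewrite /A /= !in_itv/=; have := eE _ _ mn; lra.
have Aq n x : A n x -> (0 <= (EFin \o q) x)%E.
  by rewrite /A /= in_itv/= lee_fin => xn; apply: q0; have := e0 n; lra.
have cv : (\int[mu]_(x in A n) (q x)%:E)%E @[n --> \oo] -->
    (\int[mu]_(x in \bigcup_n A n) (q x)%:E)%E.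
  apply: ge0_nondecreasing_set_cvg_integral => //.
  by move=> n; exact: measurable_itv.
apply: (@le_lt_trans _ _ C%:E); last exact: ltry.
rewrite -(cvg_lim _ cv)//; apply: lime_le; first exact: cvgP cv.
near=> n; rewrite (@continuous_FTC2 _ q G).
- rewrite -EFinB lee_fin; apply: GC; have := e0 n; have := eh n; rewrite /h; lra.
- by have := eh n; rewrite /h; lra.
- exact: qcA.
- have Gc t : a < t < b -> {for t, continuous G} by move=> /dG/is_derive_continuous.
  have := e0 n; have := eh n; rewrite /h => ? ?; split.
  + by move=> t; rewrite in_itv/= => ?; have [] : is_derive t 1 G (q t) by apply: dG; lra.
  + by apply: cvg_at_right_filter; apply: Gc; lra.
  + by apply: cvg_at_left_filter; apply: Gc; lra.
- move=> t; rewrite in_itv/= derive1E => ?.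
  by have [] : is_derive t 1 G (q t) by apply: dG; have := e0 n; lra.
Unshelve. all: by end_near. Qed.


Lemma is_derive_opp_arg f t (d : R) : is_derive (- t) 1 f d ->
  is_derive t 1 (fun u => f (- u)) (- d).
Proof.
move=> df; have dN : is_derive t 1 (fun u : R => - u) (- 1).
  by have := @is_deriveN _ _ _ id t 1 1 (is_derive_id _ _).
have := @is_derive1_comp _ f (fun u : R => - u) t _ _ df dN.
by move=> H; apply: is_derive_eq H _; rewrite mulrN1.
Qed.

Lemma bounded_primitiveN f a b : bounded_primitive (fun t => f (- t)) (- b) (- a) ->
  bounded_primitive f a b.
Proof.
move=> [G [C [dG GC]]]; exists (fun t => - G (- t)), C; split => [t tab|s t as_ st tb].
  have tN : - b < - t < - a by lra.
  have := is_derive_opp_arg (dG _ tN); rewrite opprK => /is_deriveN H.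
  by apply: is_derive_eq H _; rewrite opprK.
by have := GC (- t) (- s); lra.
Qed.

End Primitive.

(** * Linear differential equations with continuous coefficients *)

Lemma fin_upper_bound {R : realType} (X : finType) (P : X -> R -> Prop) :
  (forall x, exists K, P x K) ->
  (forall x K K', K <= K' -> P x K -> P x K') ->
  exists2 K, 0 <= K & forall x, P x K.
Proof.
move=> /choice[k Pk] Pmono; exists (\sum_x `|k x|); first exact: sumr_ge0.
move=> x; apply: Pmono (Pk x); rewrite (bigD1 x)//=.
by rewrite (le_trans (ler_norm _))// lerDl sumr_ge0.
Qed.

Section LinearODE.
Context {R : realType} {X : finType} (a b : R).
Implicit Types (f F g G : R -> R) (s t : R).

Lemma continuous_bounded f s t : {within `[s, t], continuous f} ->
  exists K, forall u, s <= u <= t -> `|f u| <= K.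
Proof.
move=> fc; have [st|ts] := leP s t; last by exists 0 => u; lra.
have [c _ cP] := @EVT_max _ (fun u => `|f u|) _ _ st
  (fun x => cvg_norm (fc x)).
by exists `|f c| => u ust; apply: cP; rewrite in_itv.
Qed.

Lemma is_derive_norm_increment F G f g :
  (forall t, a < t < b -> is_derive t 1 F (f t)) ->
  (forall t, a < t < b -> is_derive t 1 G (g t)) ->
  forall s t, a < s -> s <= t -> t < b ->
  (forall u, s <= u <= t -> `|f u| <= g u) -> `|F t - F s| <= G t - G s.
Proof.
move=> dF dG s t as_ st tb fg; rewrite ler_norml; apply/andP; split.
  have dNF u : a < u < b -> is_derive u 1 (- F) (- f u).
    by move=> /dF ?; apply: is_deriveN.
  have := is_derive_le_increment dNF dG as_ st tb; rewrite !fctE => H.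
  have {}H : - F t - - F s <= G t - G s.
    by apply: H => u ust; rewrite (le_trans _ (fg u ust))// -normrN ler_norm.
  by lra.
apply: (is_derive_le_increment dF dG as_ st tb) => u ust.
by rewrite (le_trans _ (fg u ust))// ler_norm.
Qed.

(** Uniformity is asked on compact subintervals only, because the coefficients may be unbounded at
    both ends. *)
Definition loc_unif_cvg (v_ : nat -> R -> X -> R) (v : R -> X -> R) :=
  forall s t, a < s -> t < b -> forall e, 0 < e ->
  exists N, forall n, (N <= n)%N -> forall u, s <= u <= t -> forall x,
    `|v_ n u x - v u x| <= e.

Lemma loc_unif_cauchy (v_ : nat -> R -> X -> R) :
  (forall s t, a < s -> t < b -> forall e, 0 < e ->
    exists N, forall n m, (N <= n)%N -> (N <= m)%N ->
    forall u, s <= u <= t -> forall x, `|v_ n u x - v_ m u x| <= e) ->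
  exists v, loc_unif_cvg v_ v.
Proof.
move=> vC.
have cv u x : a < u < b -> v_ n u x @[n --> \oo] --> lim (v_ n u x @[n --> \oo]).
  move=> uab; apply/cauchy_cvgP/cauchy_exP => e e0.
  have e20 : 0 < e / 2 by lra.
  have [||N NP] := vC u u _ _ (e / 2) e20; try lra.
  exists (v_ N u x); exists N => // n /= Nn; rewrite /ball /=.
  have := NP N n (leqnn N) Nn u _ x; rewrite lexx => H.
  by have := H isT; lra.
exists (fun u x => lim (v_ n u x @[n --> \oo])) => s t as_ tb e e0.
have [N NP] := vC s t as_ tb e e0; exists N => n Nn u ust x.
have uab : a < u < b by lra.
apply: (@cvgr_to_le _ \oo _ _ (fun m => `|v_ n u x - v_ m u x|)).
  by apply: cvg_norm; apply: cvgB; [exact: cvg_cst|exact: cv].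
by exists N => // m /= Nm; apply: NP.
Unshelve. all: by end_near. Qed.

Lemma loc_unif_pointwise (v_ : nat -> R -> X -> R) v : loc_unif_cvg v_ v ->
  forall t x, a < t < b -> v_ n t x @[n --> \oo] --> v t x.
Proof.
move=> vv t x tab; apply/cvgrPdist_le => e e0.
have [| |N NP] := vv t t _ _ e e0; try lra.
by exists N => // n /= Nn; rewrite distrC; apply: NP => //; rewrite lexx.
Qed.

Lemma loc_unif_continuous (v_ : nat -> R -> X -> R) v : loc_unif_cvg v_ v ->
  (forall n t x, a < t < b -> {for t, continuous (v_ n ^~ x)}) ->
  forall t x, a < t < b -> {for t, continuous (v ^~ x)}.
Proof.
move=> vv vc t x tab; apply/cvgrPdist_le => e e0.
have e30 : 0 < e / 3 by rewrite divr_gt0.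
have [| |N NP] := vv ((a + t) / 2) ((t + b) / 2) _ _ _ e30; try lra.
have NN u : (a + t) / 2 <= u <= (t + b) / 2 -> `|v_ N u x - v u x| <= e / 3.
  by move=> ?; apply: NP.
have /cvgrPdist_le/(_ _ e30) := vc N t x tab.
have ut : \forall u \near t, (a + t) / 2 < u < (t + b) / 2.
  by apply: near_oo; lra.
apply: filterS2 ut => u ut vut.
have := NN u; have := NN t; rewrite !ler_norml in vut *; lra.
Qed.

(** Increments of [v_ n] differ from those of a primitive [G] of [g] by arbitrarily little, so in
    the limit [v] and [G] have the same increments. *)
Lemma loc_unif_derive (v_ g_ : nat -> R -> X -> R) (v g : R -> X -> R) :
  a < b ->
  (forall n t x, a < t < b -> is_derive t 1 (v_ n ^~ x) (g_ n t x)) ->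
  (forall t x, a < t < b -> {for t, continuous (g ^~ x)}) ->
  loc_unif_cvg v_ v -> loc_unif_cvg g_ g ->
  forall t x, a < t < b -> is_derive t 1 (v ^~ x) (g t x).
Proof.
move=> ab dv gc vv gg t x tab.
have mab : a < (a + b) / 2 < b by lra.
have [G [_ dG]] := primitive_exists mab (gc ^~ x).
have inc s u : a < s -> s <= u -> u < b -> v u x - v s x = G u - G s.
  move=> as_ su ub; apply/eqP; rewrite -subr_eq0 -normr_le0.
  apply/ler_addgt0Pr => e e0; rewrite add0r.
  pose e' := e / (u - s + 1).
  have e'0 : 0 < e' by rewrite divr_gt0//; lra.
  have e'e : e' * (u - s) <= e by rewrite /e' mulrAC ler_pdivrMr; nra.
  have cv : `|v_ n u x - v_ n s x - (G u - G s)| @[n --> \oo] -->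
            `|v u x - v s x - (G u - G s)|.
    apply: cvg_norm; apply: cvgB; last exact: cvg_cst.
    by apply: cvgB; apply: loc_unif_pointwise vv _ _ _; lra.
  apply: (cvgr_to_le cv).
  have [N NP] := gg s u as_ ub e' e'0; exists N => // n /= Nn.
  apply: le_trans e'e.
  have dD r : a < r < b -> is_derive r 1 ((v_ n ^~ x) - G) (g_ n r x - g r x).
    by move=> rab; have := dv n r x rab; have := dG r rab => ? ?; apply: is_deriveB.
  have dL r : a < r < b -> is_derive r 1 (fun r => e' * r) e'.
    move=> _; have := @is_deriveZ _ _ _ id e' r 1 1 (is_derive_id _ _).
    by move=> H; apply: is_derive_eq H _; rewrite /GRing.scale /= mulr1.
  have := is_derive_norm_increment dD dL as_ su ub _.
  rewrite !fctE mulrBr => H; have {H} := H (fun r rsu => NP n Nn r rsu x).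
  by apply: le_trans; rewrite le_eqVlt; apply/orP; left; apply/eqP; congr (`|_|); ring.
have : is_derive t 1 (G + cst (v t x - G t)) (g t x).
  by rewrite -[g t x]addr0; apply: is_deriveD; exact: dG.
apply: near_eq_is_derive.
have : \forall u \near t, a < u < b.
  by apply: near_oo; lra.
apply: filterS => u ub; rewrite !fctE.
by have [tu|ut] := leP t u; [have := inc t u|have := inc u t]; lra.
Qed.

Definition linmap (A : R -> X -> X -> R) t (v : X -> R) x := \sum_y A t x y * v y.

Definition linear_solution A (v : R -> X -> R) :=
  forall t x, a < t < b -> is_derive t 1 (v ^~ x) (linmap A t (v t) x).

Context (A : R -> X -> X -> R).
Hypothesis ab : a < b.
Hypothesis A_cont : forall x y t, a < t < b -> {for t, continuous (fun u => A u x y)}.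

Lemma linmap_continuous (v : R -> X -> R) :
  (forall t x, a < t < b -> {for t, continuous (v ^~ x)}) ->
  forall t x, a < t < b -> {for t, continuous (fun u => linmap A u (v u) x)}.
Proof.
move=> vc t x tab; rewrite /linmap /continuous_at /=.
apply: cvg_bigsum => y _; apply: cvgM; first exact: A_cont.
exact: vc.
Qed.

Lemma A_bounded s t : a < s -> t < b ->
  exists2 K, 0 <= K & forall u, s <= u <= t -> forall x y, `|A u x y| <= K.
Proof.
move=> as_ tb.
have [|p K K' KK' KP u ?|K K0 KP] := @fin_upper_bound _ (X * X)%type
    (fun p K => forall u, s <= u <= t -> `|A u p.1 p.2| <= K).
- move=> [x y] /=; apply: continuous_bounded.
  by apply: oo_continuous_within as_ tb => u; apply: A_cont.
- by apply: le_trans KK'; exact: KP.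
- by exists K => // u ust x y; apply: (KP (x, y)).
Qed.

Lemma linmap_norm_le K M t v x : (forall x y, `|A t x y| <= K) ->
  (forall y, `|v y| <= M) -> `|linmap A t v x| <= #|X|%:R * (K * M).
Proof.
move=> AK vM; rewrite (le_trans (ler_norm_sum _ _ _))//.
have -> : #|X|%:R * (K * M) = \sum_(y : X) K * M.
  by rewrite sumr_const mulr_natl.
apply: ler_sum => y _; rewrite normrM.
by apply: ler_pM => //; exact: AK.
Qed.

Lemma linmapB t v w x : linmap A t v x - linmap A t w x = linmap A t (fun y => v y - w y) x.
Proof. by rewrite /linmap -sumrB; apply: eq_bigr => y _; rewrite mulrBr. Qed.

Lemma linmap_loc_unif (w_ : nat -> R -> X -> R) w : loc_unif_cvg w_ w ->
  loc_unif_cvg (fun n t => linmap A t (w_ n t)) (fun t => linmap A t (w t)).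
Proof.
move=> ww s t as_ tb e e0.
have [K K0 KP] := A_bounded as_ tb.
have N0 : 0 <= #|X|%:R :> R by [].
pose e' := e / (#|X|%:R * K + 1).
have e'0 : 0 < e' by rewrite divr_gt0//; nra.
have e'e : #|X|%:R * (K * e') <= e.
  by rewrite mulrA /e' mulrA ler_pdivrMr; nra.
have [N NP] := ww s t as_ tb e' e'0; exists N => n Nn u ust x.
rewrite linmapB (le_trans _ e'e)// linmap_norm_le//; first exact: KP.
by move=> y; exact: NP.
Qed.

(** There are two sequences because the derivative of a Picard iterate involves the preceding
    iterate; for exact solutions they coincide. *)
Lemma linear_limit (v_ w_ : nat -> R -> X -> R) v :
  (forall n t x, a < t < b -> is_derive t 1 (v_ n ^~ x) (linmap A t (w_ n t) x)) ->
  loc_unif_cvg v_ v -> loc_unif_cvg w_ v -> linear_solution A v.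
Proof.
move=> dv vv wv t x tab.
have vc := loc_unif_continuous vv (fun n t x tab => is_derive_continuous (dv n t x tab)).
apply: (@loc_unif_derive v_ (fun n u => linmap A u (w_ n u)) v
  (fun u => linmap A u (v u))) => //; first exact: linmap_continuous.
exact: linmap_loc_unif.
Qed.

Lemma is_derive_expL c L s t :
  is_derive t 1 (fun u => c * expR (L * (u - s))) (c * L * expR (L * (t - s))).
Proof.
have dL : is_derive t 1 (fun u => L * (u - s)) L.
  have : is_derive t 1 (id - cst s) (1 - 0) by apply: is_deriveB.
  by move=> /(is_deriveZ L) H; apply: is_derive_eq H _; rewrite subr0 /GRing.scale /= mulr1.
have := @is_derive1_comp _ expR (fun u => L * (u - s)) t _ _ (is_derive_expR _) dL.
move=> /(is_deriveZ c) H; apply: is_derive_eq H _.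
by rewrite /GRing.scale /=; ring.
Qed.

(* Picard iteration; in the weight [expR (L * `|t - s|)] with [L = 2 K #|X|]
   the integral operator is a contraction of ratio 1/2 on both sides of [s]. *)
Lemma linear_solution_exists s (v0 : X -> R) : a < s < b ->
  exists2 v, linear_solution A v & forall x, v s x = v0 x.
Proof.
move=> sab.
(* With continuity inside the existential, [choice] gives a total operator [prim], and the iterates
   can be defined before they are known to be continuous. *)
have Pr f : exists F : R -> R, (forall t, a < t < b -> {for t, continuous f}) ->
    F s = 0 /\ forall t, a < t < b -> is_derive t 1 F (f t).
  have [fc|] := pselect (forall t, a < t < b -> {for t, continuous f}).
    by have [F FP] := primitive_exists sab fc; exists F.
  by exists (fun=> 0).
have {Pr} [prim primP] := choice Pr.
pose v_ := fix v_ n t x := if n is n'.+1 then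
  v0 x + prim (fun u => linmap A u (v_ n' u) x) t else v0 x.
have vc n : forall t x, a < t < b -> {for t, continuous (v_ n ^~ x)}.
  elim: n => [|n IH] t x tab; first exact: cvg_cst.
  have [|_ dP] := primP (fun u => linmap A u (v_ n u) x).
    by move=> ? ?; apply: linmap_continuous.
  by apply: cvgD; [exact: cvg_cst|apply: is_derive_continuous (dP t tab)].
have dv n t x : a < t < b -> is_derive t 1 (v_ n.+1 ^~ x) (linmap A t (v_ n t) x).
  move=> tab; have [|_ dP] := primP (fun u => linmap A u (v_ n u) x).
    by move=> ? ?; apply: linmap_continuous => //; exact: vc.
  have := is_deriveD (is_derive_cst (v0 x) t 1) (dP t tab).
  by move=> H; apply: is_derive_eq H _; rewrite add0r.
have vs n x : v_ n s x = v0 x.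
  case: n => [//|n] /=; have [|-> _] := primP (fun u => linmap A u (v_ n u) x).
    by move=> ? ?; apply: linmap_continuous => //; exact: vc.
  by rewrite addr0.
have geo p t : a < p <= s -> s <= t < b -> exists2 C, 0 <= C &
    forall n u x, p <= u <= t -> `|v_ n.+1 u x - v_ n u x| <= C * 2^-1 ^+ n.
  move=> pas stb.
  have [ap tb] : a < p /\ t < b by lra.
  have [K K0 KP] := A_bounded ap tb.
  have [x|x M M' MM' MP u ?|M M0 MP] := @fin_upper_bound R X
    (fun x M => forall u, p <= u <= t -> `|v_ 1%N u x - v_ 0%N u x| <= M).
  - apply: continuous_bounded; apply: (@oo_continuous_within _ _ a b) => //.
    by move=> u uab; apply: cvgB; exact: vc.
  - by apply: le_trans MM'; exact: MP.
  pose L := 2 * (#|X|%:R * K).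
  have L0 : 0 <= L by rewrite !mulr_ge0.
  have E1 u : 0 <= u -> 1 <= expR (L * u).
    by move=> u0; rewrite -expR0 ler_expR mulr_ge0.
  pose c n := M * 2^-1 ^+ n.
  have c0 n : 0 <= c n by rewrite mulr_ge0// exprn_ge0.
  have step n : forall u x, p <= u <= t ->
      `|v_ n.+1 u x - v_ n u x| <= c n * expR (L * `|u - s|).
    elim: n => [|n IH] u x put.
      apply: le_trans (MP x u put) _.
      by rewrite /c expr0 mulr1 ler_peMr// E1.
    have dD r : a < r < b -> is_derive r 1 ((v_ n.+2 ^~ x) - (v_ n.+1 ^~ x))
        (linmap A r (fun y => v_ n.+1 r y - v_ n r y) x).
      move=> rab; rewrite -linmapB; have := dv n.+1 r x rab; have := dv n r x rab.
      by move=> ? ?; apply: is_deriveB.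
    have bnd r : p <= r <= t -> `|linmap A r (fun y => v_ n.+1 r y - v_ n r y) x| <=
        c n.+1 * L * expR (L * `|r - s|).
      move=> prt; have -> : c n.+1 * L * expR (L * `|r - s|) =
          #|X|%:R * (K * (c n * expR (L * `|r - s|))).
        by rewrite /c /L exprS; field.
      by apply: linmap_norm_le => [|y]; [exact: KP|exact: IH].
    have [su|us] := leP s u.
      have := is_derive_norm_increment dD (fun r _ => is_derive_expL (c n.+1) L s r)
        (_ : a < s) su (_ : u < b) _.
      rewrite !fctE !vs !subrr subr0 mulr0 expR0 mulr1 => H.
      rewrite (ger0_norm (_ : 0 <= u - s)) ?subr_ge0//.
      have {}H := H ltac:(lra) ltac:(lra); rewrite (le_trans (H _))//.
        move=> r rsu; apply: le_trans (bnd r _) _; first lra.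
        by rewrite (ger0_norm (_ : 0 <= r - s))//; lra.
      by have := c0 n.+1; lra.
    (* To the left of [s] the weight decreases in time; its negative is the increasing comparison
       function. *)
    have dG r : a < r < b -> is_derive r 1
        (fun u => - c n.+1 * expR (- L * (u - s))) (c n.+1 * L * expR (- L * (r - s))).
      by move=> _; apply: is_derive_eq (is_derive_expL _ _ _ _) _; ring.
    have := is_derive_norm_increment dD dG (_ : a < u) (ltW us) (_ : s < b) _.
    rewrite !fctE !vs !subrr mulr0 expR0 mulr1 sub0r normrN => H.
    rewrite (ltr0_norm (_ : u - s < 0)) ?subr_lt0//.
    have {}H := H ltac:(lra) ltac:(lra); rewrite (le_trans (H _))//.
      move=> r rsu; apply: le_trans (bnd r _) _; first lra.
      by rewrite (ler0_norm (_ : r - s <= 0)) ?mulNr ?mulrN//; lra.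
    have -> : L * - (u - s) = - L * (u - s) by ring.
    by have := c0 n.+1; lra.
  exists (M * expR (L * (t - p))); first by rewrite mulr_ge0// expR_ge0.
  move=> n u x put; apply: le_trans (step n u x put) _.
  rewrite /c mulrAC ler_wpM2r ?exprn_ge0//.
  rewrite ler_wpM2l// ler_expR ler_wpM2l// ler_norml; lra.
have cauchy : exists v, loc_unif_cvg v_ v.
  apply: loc_unif_cauchy => p t ap tb e e0.
  (* The geometric bound is available on intervals that contain [s]. *)
  have [||C C0 CP] := geo (Num.min p s) (Num.max t s).
  - by rewrite lt_min ge_min lexx orbT andbT; lra.
  - by rewrite gt_max le_max lexx orbT /=; lra.
  have CP' n u x : p <= u <= t -> `|v_ n.+1 u x - v_ n u x| <= C * 2^-1 ^+ n.
    by move=> put; apply: CP; rewrite ge_min le_max; apply/andP; split; apply/orP; left; lra.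
  have tel n k u x : p <= u <= t ->
      `|v_ (n + k)%N u x - v_ n u x| <= 2 * C * 2^-1 ^+ n - 2 * C * 2^-1 ^+ (n + k).
    move=> put; elim: k => [|k IH]; first by rewrite addn0 !subrr normr0.
    rewrite addnS exprS; have := CP' (n + k)%N u x put; move: IH.
    rewrite !ler_norml; lra.
  have hcv : 2 * C * 2^-1 ^+ n @[n --> \oo] --> (2 * C * 0 : R).
    by apply: cvgMl_tmp; apply: cvg_expr; rewrite ger0_norm//; lra.
  have /cvgrPdist_le/(_ e e0)[N _ NP] := hcv.
  have NP' n k u x : (N <= n)%N -> p <= u <= t -> `|v_ (n + k)%N u x - v_ n u x| <= e.
    move=> Nn put; apply: le_trans (tel n k u x put) _.
    have := NP n Nn; rewrite mulr0 sub0r normrN ler_norml.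
    have : 0 <= 2 * C * 2^-1 ^+ (n + k) by rewrite mulr_ge0 ?exprn_ge0// mulr_ge0.
    lra.
  exists N => n m Nn Nm u put x.
  have [nm|mn] := leqP n m.
    by rewrite distrC -(subnKC nm); apply: NP'.
  by rewrite -(subnKC (ltnW mn)); apply: NP'.
have [v vv] := cauchy; exists v.
  apply: (linear_limit dv _ vv) => p t ap tb e e0.
  by have [N NP] := vv p t ap tb e e0; exists N => n Nn; apply: NP; rewrite leqW.
move=> x; have vx := loc_unif_pointwise vv (x := x) sab.
apply: (cvg_unique _ vx) => //.
by apply: cvg_near_cst; apply: nearW => n; exact: vs.
Qed.

End LinearODE.

(** * Contraction and drift estimates *)

Lemma is_derive_near_right {R : realType} (f : R -> R) (t d e : R) :
  is_derive t 1 f d -> 0 < e ->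
  \forall u \near t^'+, `|f u - f t - (u - t) * d| <= e * (u - t).
Proof.
move=> [df <-] e0; move: df => /cvg_ex[l fl].
have -> : 'D_1 f t = l by apply: cvg_lim.
move/cvgrPdist_le : fl => /(_ e e0); rewrite near_withinE.
move=> /nbhs_ballP[r /= r0 rP]; apply/near_rightP; exists r => // u utr.
have h0 : 0 < u - t by lra.
have := rP (u - t); rewrite /ball /= sub0r normrN gtr0_norm//.
rewrite gt_eqF// /GRing.scale /= mulr1 => H; have {H} := H ltac:(lra) isT.
rewrite (_ : u - t + t = u); last by ring.
rewrite -(ler_pM2r h0) -{2}(gtr0_norm h0) -normrM.
rewrite distrC mulrBl mulrAC mulVf ?mul1r ?gt_eqF//.
by rewrite (mulrC l).
Qed.

Section Flow.
Context {R : realType} {X : finType} (a b : R) (q : R -> X -> X -> R).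
Implicit Types (s t K C : R) (rho w : R -> X -> R).
Hypothesis q_ge0 : forall t x y, a < t < b -> x != y -> 0 <= q t x y.

(* [rho] solves the heat equation on ]a, b[ up to an error of size [K], in the
   sense of right difference quotients. *)
Definition approx_heat K rho :=
  (forall t x, a < t < b -> {for t, continuous (rho ^~ x)}) /\
  (forall t x, a < t < b -> \forall u \near t^'+,
     `|rho u x - rho t x - (u - t) * laplacian (q t) (rho t) x| <= K * (u - t)).

Definition heat_flow v := forall t x, a < t < b ->
  is_derive t 1 (v ^~ x) (laplacian (q t) (v t) x).

Definition dual_flow w := forall t x, a < t < b ->
  is_derive t 1 (w ^~ x) (dual_laplacian (q t) (w t) x).

Lemma laplacianN (Q : X -> X -> R) f x :
  laplacian Q (fun y => - f y) x = - laplacian Q f x.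
Proof. by rewrite /laplacian -sumrN; apply: eq_bigr => y _; ring. Qed.

Lemma approx_heatN K rho : approx_heat K rho ->
  approx_heat K (fun t x => - rho t x).
Proof.
move=> [rc rh]; split=> t x tab; first by apply: cvgN; exact: rc.
apply: filterS (rh t x tab) => u; rewrite laplacianN -normrN.
by congr (`|_| <= _); ring.
Qed.

Lemma heat_flow_approx v e : heat_flow v -> 0 < e -> approx_heat e v.
Proof.
move=> vh e0; split=> t x tab; have dv := vh t x tab.
  exact: is_derive_continuous dv.
exact: is_derive_near_right dv e0.
Qed.

(** A maximum principle that does not see the rates inside the fibres of [p]: these only pull
    [rho t x] towards values subject to the same upper bound. The rates between fibres contribute at
    most [C] and the error at most [K] to the slope of the bound. *)
Lemma approx_heat_le (Z : eqType) (p : X -> Z) (g : Z -> R) K C rho :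
  approx_heat K rho ->
  (forall t x, a < t < b ->
    \sum_(y | p y != p x) (rho t y - rho t x) * q t x y <= C) ->
  forall s t, a < s -> s <= t -> t < b -> (forall x, rho s x <= g (p x)) ->
  forall x, rho t x <= g (p x) + (K + C) * (t - s).
Proof.
move=> [rc rh] rC s t as_ st tb rs.
apply: (@real_induction _ (fun t => forall x, rho t x <= g (p x) + (K + C) * (t - s)) s t) => //.
- by move=> x; rewrite subrr mulr0 addr0.
- move=> u su ru; apply: filter_forall => x.
  have uab : a < u < b by lra.
  pose S := \sum_y `|q u x y|.
  have S0 : 0 <= S by apply: sumr_ge0.
  pose m := g (p x) + (K + C) * (u - s).
  have lapS : laplacian (q u) (rho u) x <= (m - rho u x) * S + C.
    rewrite /laplacian (bigID (fun y => p y == p x))/=; apply: lerD; last exact: rC.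
    rewrite /S mulr_sumr [leRHS](bigID (fun y => p y == p x))/= -[leLHS]addr0.
    apply: lerD; last by apply: sumr_ge0 => y _; rewrite mulr_ge0// subr_ge0 ru.
    apply: ler_sum => y /eqP yx; have [->|xy] := eqVneq x y.
      by rewrite subrr mul0r mulr_ge0// /m -yx subr_ge0 ru.
    rewrite ger0_norm; last by apply: q_ge0.
    by rewrite ler_wpM2r ?q_ge0// lerB// /m -yx.
  (* For so short a step [1 - (v - u) * S] is nonnegative, hence an Euler step starting below [m]
     overshoots [m] by no more than the terms in [K] and [C]. *)
  have small : \forall v \near u^'+, (v - u) * S <= 1.
    apply/near_rightP; exists ((S + 1)^-1); first by rewrite invr_gt0; lra.
    move=> v /andP[uv vu]; apply: (@le_trans _ _ ((S + 1)^-1 * S)).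
      by rewrite ler_wpM2r//; lra.
    by rewrite mulrC ler_pdivrMr; lra.
  have right : \forall v \near u^'+, u < v by exact: nbhs_right_gt.
  near=> v.
  have uv : u < v by near: v.
  have vS : (v - u) * S <= 1 by near: v.
  have : `|rho v x - rho u x - (v - u) * laplacian (q u) (rho u) x| <= K * (v - u).
    by near: v; exact: rh.
  rewrite ler_norml => /andP[_ rv].
  have l1 : (v - u) * laplacian (q u) (rho u) x <= (v - u) * ((m - rho u x) * S + C).
    by rewrite ler_pM2l//; lra.
  have l2 : 0 <= (m - rho u x) * (1 - (v - u) * S).
    by rewrite mulr_ge0//; have := ru x; rewrite /m; lra.
  have -> : g (p x) + (K + C) * (v - s) = m + (K + C) * (v - u) by rewrite /m; ring.
  lra.
- move=> u su ru x.
  suff : rho u x - (K + C) * (u - s) <= g (p x) by lra.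
  apply: (@le_left_limit _ (fun u => rho u x - (K + C) * (u - s)) s) => //.
  + apply: cvgB; first by apply: rc; lra.
    apply: cvgM; first exact: cvg_cst.
    by apply: cvgB; [exact: cvg_id|exact: cvg_cst].
  + by lra.
  + by move=> v vu; have := ru v vu x; lra.
Unshelve. all: by end_near. Qed.

Lemma approx_heat_drift (Z : eqType) (p : X -> Z) (g : Z -> R) K C rho :
  approx_heat K rho ->
  (forall t x, a < t < b ->
    `|\sum_(y | p y != p x) (rho t y - rho t x) * q t x y| <= C) ->
  forall s t, a < s -> s <= t -> t < b -> (forall x, rho s x = g (p x)) ->
  forall x, `|rho t x - g (p x)| <= (K + C) * (t - s).
Proof.
move=> rh rC s t as_ st tb rs x.
have H1 : rho t x <= g (p x) + (K + C) * (t - s).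
  apply: (@approx_heat_le _ p g K C _ rh) => //; last by move=> y; rewrite rs.
  by move=> u y uab; apply: le_trans (ler_norm _) (rC u y uab).
have H2 : - rho t x <= - g (p x) + (K + C) * (t - s).
  apply: (@approx_heat_le _ p (fun z => - g z) K C _ (approx_heatN rh)) => //.
    move=> u y uab; apply: le_trans _ (rC u y uab); rewrite -normrN.
    apply: le_trans _ (ler_norm _); rewrite -sumrN.
    by rewrite le_eqVlt; apply/orP; left; apply/eqP; apply: eq_bigr => z _; ring.
  by move=> y; rewrite rs.
rewrite ler_norml; lra.
Qed.

Lemma heat_flow_sup v M : heat_flow v ->
  forall s t, a < s -> s <= t -> t < b -> (forall x, `|v s x| <= M) ->
  forall x, `|v t x| <= M.
Proof.
have half w : heat_flow w -> forall s t, a < s -> s <= t -> t < b ->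
    (forall x, w s x <= M) -> forall x, w t x <= M.
  move=> wh s t as_ st tb ws x; apply/ler_addgt0Pr => e e0.
  pose e' := e / (t - s + 1).
  have e'0 : 0 < e' by rewrite divr_gt0//; lra.
  have e'e : e' * (t - s) <= e by rewrite /e' mulrAC ler_pdivrMr; nra.
  (* With a single fibre the sum over the other fibres is empty, so [C = 0]. *)
  have := @approx_heat_le unit (fun=> tt) (fun=> M) e' 0 w (heat_flow_approx wh e'0).
  move=> H; have := H _ s t as_ st tb ws x; rewrite addr0.
  move=> {}H; apply: le_trans (H _) _; last by lra.
  by move=> u y _; rewrite big_pred0// => z; rewrite eqxx.
move=> vh s t as_ st tb vs x; rewrite ler_norml; apply/andP; split.
  rewrite lerNl; apply: (half (fun t x => - v t x) _ s t) => //.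
    move=> u y uab; rewrite laplacianN; have := vh u y uab.
    exact: is_deriveN.
  by move=> y; rewrite (le_trans _ (vs y))// -normrN ler_norm.
by apply: (half v vh s t) => // y; rewrite (le_trans _ (vs y))// ler_norm.
Qed.

(** The matrix of a short Euler step has nonnegative entries and column sums 1, since what leaves a
    point arrives at the others. Such a matrix does not increase the l1 norm, and the remaining
    error is of lower order than the step. *)
Lemma dual_flow_l1 w : dual_flow w ->
  forall s t, a < s -> s <= t -> t < b -> \sum_x `|w t x| <= \sum_x `|w s x|.
Proof.
move=> wd s t as_ st tb.
suff : \sum_x `|w t x| <= \sum_x `|w s x| + 0 * (t - s) by lra.
apply: (@dini_le _ (fun t => \sum_x `|w t x|) a b 0) => // u uab.
  apply: cvg_bigsum => x _; apply: cvg_norm.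
  exact: is_derive_continuous (wd u x uab).
move=> e e0; rewrite add0r.
pose S x := \sum_(y | y != x) q u x y.
have S0 x : 0 <= S x by apply: sumr_ge0 => y yx; rewrite q_ge0// eq_sym.
(* Errors of size [e / N] in each coordinate add up to at most [e]; the summand 1 covers an empty
   [X]. *)
pose N : R := #|X|%:R + 1.
have N0 : 0 < N by rewrite ltr_wpDl.
have eN : 0 < e / N by rewrite divr_gt0.
have small : \forall v \near u^'+, forall x, (v - u) * S x <= 1.
  apply: filter_forall => x; apply/near_rightP; exists ((S x + 1)^-1).
    by rewrite invr_gt0; have := S0 x; lra.
  move=> v /andP[uv vu]; apply: (@le_trans _ _ ((S x + 1)^-1 * S x)).
    by rewrite ler_wpM2r//; lra.
  by rewrite mulrC ler_pdivrMr; have := S0 x; lra.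
have expand : \forall v \near u^'+, forall x,
    `|w v x - w u x - (v - u) * dual_laplacian (q u) (w u) x| <= e / N * (v - u).
  by apply: filter_forall => x; exact: is_derive_near_right (wd u x uab) eN.
near=> v.
have uv : u < v by near: v; exact: nbhs_right_gt.
have vS x : (v - u) * S x <= 1 by move: x; near: v.
have ex x : `|w v x - w u x - (v - u) * dual_laplacian (q u) (w u) x| <= e / N * (v - u).
  by move: x; near: v.
have step x : `|w v x| <= (1 - (v - u) * S x) * `|w u x| +
    (v - u) * \sum_(y | y != x) q u y x * `|w u y| + e / N * (v - u).
  pose I := \sum_(y | y != x) q u y x * w u y.
  have dE : dual_laplacian (q u) (w u) x = I - S x * w u x.
    by rewrite /dual_laplacian sumrB mulr_suml.
  have -> : w v x = (1 - (v - u) * S x) * w u x + (v - u) * I +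
     (w v x - w u x - (v - u) * dual_laplacian (q u) (w u) x) by rewrite dE; ring.
  rewrite (le_trans (ler_normD _ _))// lerD//.
  rewrite (le_trans (ler_normD _ _))// lerD// normrM ger0_norm//.
  - by rewrite subr_ge0.
  - rewrite ler_wpM2l//; first lra.
    rewrite (le_trans (ler_norm_sum _ _ _))//; apply: ler_sum => y yx.
    by rewrite normrM ger0_norm// q_ge0.
  - lra.
apply: (le_trans (ler_sum _ (fun x _ => step x))).
rewrite !big_split/= -mulr_sumr.
have -> : \sum_x \sum_(y | y != x) q u y x * `|w u y| = \sum_x S x * `|w u x|.
  rewrite (exchange_big_dep predT)//=; apply: eq_bigr => y _.
  by rewrite /S mulr_suml; apply: eq_bigl => z; rewrite eq_sym.
rewrite sumr_const -[X in _ + X <= _]mulr_natl.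
have -> : \sum_x (1 - (v - u) * S x) * `|w u x| =
    \sum_x `|w u x| - (v - u) * \sum_x S x * `|w u x|.
  by rewrite mulr_sumr -sumrB; apply: eq_bigr => x _; ring.
rewrite subrK lerD2l mulrA ler_wpM2r//; first lra.
rewrite mulrA ler_pdivrMr// mulrC ler_wpM2l//; first lra.
by rewrite /N lerDl.
Unshelve. all: by end_near. Qed.

Lemma dual_laplacian_density t (w p : X -> R) x :
  (forall x, p x != 0) -> (forall x y, q t x y * p x = q t y x * p y) ->
  laplacian (q t) (fun y => w y / p y) x = dual_laplacian (q t) w x / p x.
Proof.
move=> p0 db; rewrite /laplacian /dual_laplacian (bigD1 x)//= subrr mul0r add0r.
rewrite mulr_suml; apply: eq_bigr => y yx.
have -> : q t x y = q t y x * p y / p x by rewrite -db mulfK.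
by field; rewrite !p0.
Qed.

(** Detailed balance makes the derivative of [w], divided by [p], the Laplacian of the density. The
    factor [1 / p] changes at rate at most [k / c ^+ 2], which multiplied by the bound [B] on [w]
    gives the main part of the error size; the summand 1 absorbs lower-order terms. *)
Lemma dual_flow_approx w (p : R -> X -> R) c k B : dual_flow w ->
  0 < c -> 0 <= k ->
  (forall t x, a < t < b -> c <= p t x) ->
  (forall s t x, a < s < b -> a < t < b -> `|p s x - p t x| <= k * `|s - t|) ->
  (forall t x y, a < t < b -> q t x y * p t x = q t y x * p t y) ->
  (forall t x, a < t < b -> `|w t x| <= B) ->
  approx_heat (B * k / c ^+ 2 + 1) (fun t x => w t x / p t x).
Proof.
move=> wd c0 k0 pc pk db wB.
have p0 t x : a < t < b -> 0 < p t x by move=> tab; apply: lt_le_trans (pc t x tab).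
have p_cont t x : a < t < b -> {for t, continuous (p ^~ x)}.
  by move=> tab; apply: (lipschitz_continuous_oo k0 _ tab) => r u rab uab; exact: pk.
split=> t x tab.
  apply: cvgM; first exact: is_derive_continuous (wd t x tab).
  by apply: cvgV; [rewrite gt_eqF// p0|exact: p_cont].
rewrite dual_laplacian_density; [|by move=> y; rewrite gt_eqF// p0|by move=> *; exact: db].
set D := dual_laplacian _ _ _.
have c20 : 0 < c / 2 by lra.
have B0 : 0 <= B by apply: le_trans (wB t x tab).
have exw := is_derive_near_right (wd t x tab) c20.
(* Below this step length the product of the two increments costs at most [(u - t) / 2]; the other
   half of the summand 1 pays for the difference quotient of [w]. *)
have r0 : 0 < c ^+ 2 / (2 * (k * `|D| + 1)).
  by rewrite divr_gt0 ?exprn_gt0// mulr_gt0// ltr_wpDl// mulr_ge0.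
near=> u.
have tu : t < u by near: u; exact: nbhs_right_gt.
have ub : u < b by near: u; apply: nbhs_right_lt; lra.
have uab : a < u < b by lra.
have ew : `|w u x - w t x - (u - t) * D| <= c / 2 * (u - t) by near: u.
have ur : u < t + c ^+ 2 / (2 * (k * `|D| + 1)).
  by near: u; apply: nbhs_right_lt; lra.
have pu := p0 u x uab; have pt := p0 t x tab.
have -> : w u x / p u x - w t x / p t x - (u - t) * (D / p t x) =
  (w u x - w t x - (u - t) * D) / p u x +
  (w t x + (u - t) * D) * ((p t x - p u x) / (p u x * p t x)).
  by field; rewrite !gt_eqF.
apply: (@le_trans _ _ (1 / 2 * (u - t) + (B + (u - t) * `|D|) * (k * (u - t) / c ^+ 2))).
  rewrite (le_trans (ler_normD _ _))// lerD//.
    rewrite normrM normfV (gtr0_norm pu) ler_pdivrMr// (le_trans ew)//.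
    have := pc u x uab; nra.
  rewrite normrM ler_pM//.
    rewrite (le_trans (ler_normD _ _))// lerD ?wB//.
    by rewrite normrM gtr0_norm//; lra.
  rewrite normrM normfV (gtr0_norm (mulr_gt0 pu pt)) ler_pM//.
  - by rewrite invr_ge0 mulr_ge0// ltW.
  - by rewrite (le_trans (pk _ _ _ _ _))// ltr0_norm; lra.
  - rewrite lef_pV2 ?posrE ?mulr_gt0 ?exprn_gt0// expr2 ler_pM//; [lra|lra|exact: pc|exact: pc].
have : (u - t) * (k * `|D|) / c ^+ 2 <= 1 / 2.
  rewrite ler_pdivrMr ?exprn_gt0//.
  have kD : 0 <= k * `|D| by rewrite mulr_ge0.
  have : (u - t) * (k * `|D| + 1) <= 1 / 2 * c ^+ 2.
    rewrite -ler_pdivlMr; last lra.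
    have -> : 1 / 2 * c ^+ 2 / (k * `|D| + 1) = c ^+ 2 / (2 * (k * `|D| + 1)).
      by field; rewrite gt_eqF//; lra.
    lra.
  nra.
move=> H.
have -> : (B + (u - t) * `|D|) * (k * (u - t) / c ^+ 2) =
  B * k / c ^+ 2 * (u - t) + (u - t) * (k * `|D|) / c ^+ 2 * (u - t).
  by field; rewrite gt_eqF.
nra.
Unshelve. all: by end_near. Qed.

End Flow.

(** * Energies and convergence at the end of an interval *)

Lemma nonincreasing_cvg_left {R : realType} (F : R -> R) a b M : a < b ->
  (forall s t, a < s -> s <= t -> t < b -> F t <= F s) ->
  (forall t, a < t < b -> M <= F t) ->
  cvg (F t @[t --> b^'-]).
Proof.
move=> ab Fd FM; rewrite -(opprK F); apply: is_cvgN.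
have nab := near_left_oo ab.
apply: nondecreasing_at_left_is_cvgr.
  apply: filterS nab => x xab u v; rewrite !in_itv/= => ux vx uv.
  by rewrite lerN2; apply: Fd => //; lra.
apply: filterS nab => x xab; exists (- M) => _ [u + <-]; rewrite /= in_itv/= => ux.
by rewrite lerN2; apply: FM; lra.
Qed.

Lemma exists_avoid {R : realType} (s : seq R) (e : R) : 0 < e ->
  exists2 d, 0 < d < e & forall u, 0 < u <= d -> u \notin s.
Proof.
move=> e0; elim: s => [|c s [d de dP]]; first by exists (e / 2) => //; lra.
have [c0|c0] := ltP 0 c; last first.
  by exists d => // u ud; rewrite inE negb_or dP// andbT gt_eqF//; lra.
pose m := Num.min d c.
have [mc md] : m <= c /\ m <= d by rewrite !ge_min !lexx orbT.
have m0 : 0 < m by rewrite lt_min; lra.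
exists (m / 2) => [|u um]; first by lra.
by rewrite inE negb_or dP ?andbT ?lt_eqF//; lra.
Qed.

(** The product measures the distance of [f t] to the finite set [s]. A continuous [f] that is near
    [l] at arbitrarily late times and yet leaves a neighbourhood of [l] must cross [l + r] or
    [l - r], where the product is bounded away from 0. *)
Lemma cvg_left_of_finite_cluster {R : realType} (f : R -> R) a b (s : seq R) (l : R) : a < b ->
  (forall t, a < t < b -> {for t, continuous f}) ->
  \prod_(c <- s) (f t - c) ^+ 2 @[t --> b^'-] --> (0 : R) ->
  (forall e d, 0 < e -> d < b -> exists2 t, d < t < b & `|f t - l| < e) ->
  f t @[t --> b^'-] --> l.
Proof.
move=> ab fc f0 fl; apply/cvgrPdist_le => e e0; apply: contrapT => nfe.
pose phi u := \prod_(c <- s) (u - c) ^+ 2.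
(* The two lists exclude the radii for which [l + r], respectively [l - r], lies in [s]. *)
have [r re rP] := exists_avoid ([seq c - l | c <- s] ++ [seq l - c | c <- s]) e0.
have phir u : u = l + r \/ u = l - r -> 0 < phi u.
  move=> ur; rewrite /phi big_seq; apply: prodr_gt0 => c cs.
  rewrite exprn_even_gt0//= subr_eq0; apply/eqP => uc.
  have := rP r; rewrite lexx andbT mem_cat negb_or => /(_ ltac:(lra)) /andP[/negP h1 /negP h2].
  case: ur => ur; [apply: h1|apply: h2]; apply/mapP; exists c => //; lra.
pose eta := Num.min (phi (l + r)) (phi (l - r)).
have eta0 : 0 < eta by rewrite lt_min !phir//; [right|left].
have neta : \forall t \near b^'-, phi (f t) < eta by apply: (cvgr_lt _ f0).
have [m amb dP] := near_left_interval ab neta.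
have mb : m < b by lra.
have [t1 t1b ft1] := fl r m ltac:(lra) mb.
have [t2 t2b ft2] : exists2 t, m < t < b & e < `|f t - l|.
  apply: contrapT => nt; apply: nfe; apply/near_leftP; exists (b - m); first lra.
  move=> t tb; rewrite distrC leNgt; apply/negP => et; apply: nt.
  by exists t => //; lra.
(* The intermediate value theorem at level [r]; minimum and maximum make it apply whichever of the
   near and the far time comes first. *)
have key u v : u \in `]m, b[ -> v \in `]m, b[ -> u <= v ->
    Num.min `|f u - l| `|f v - l| <= r <= Num.max `|f u - l| `|f v - l| -> False.
  rewrite !in_itv /= => um vm uv ruv.
  have gc : {within `[u, v], continuous (fun t => `|f t - l|)}.
    apply: (@oo_continuous_within _ _ a b); [|lra|lra] => t tab.
    by apply: cvg_norm; apply: cvgB; [exact: fc|exact: cvg_cst].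
  have [t3] := IVT uv gc ruv; rewrite in_itv /= => t3uv ft3.
  have : phi (f t3) < eta by apply: dP; lra.
  have [fE|fE] : f t3 = l + r \/ f t3 = l - r.
    by have [p|p] := ger0P (f t3 - l); move: ft3; [rewrite ger0_norm//|rewrite ltr0_norm//]; lra.
  - by rewrite fE lt_min ltxx.
  - by rewrite fE lt_min ltxx andbF.
have [t12|t21] := leP t1 t2.
  apply: (key t1 t2) => //; rewrite ?in_itv//=.
  by rewrite ge_min le_max; apply/andP; split; apply/orP; [left|right]; lra.
apply: (key t2 t1); [by rewrite in_itv|by rewrite in_itv|exact: ltW|].
by rewrite ge_min le_max; apply/andP; split; apply/orP; [right|left]; lra.
Qed.

(** Compactness of [[- B, B]]. Along one ultrafilter all coordinates converge at once, without
    extracting subsequences. *)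
Lemma ultra_bounded_cvg {R : realType} (T : Type) (U : set_system T) (f : T -> R) B :
  UltraFilter U -> U [set t | `|f t| <= B] -> exists l : R, f t @[t --> U] --> l.
Proof.
move=> UU fB.
have [|l [_ lcl]] := @segment_compact R (- B) B (f @ U) _.
  by apply: filterS fB => t tB; rewrite /= in_itv /= -ler_norml; exact: tB.
exists l => V Vl; have [//|nV] := in_ultra_setVsetC (f @^-1` V) UU.
by have [u [/= nVu Vu]] := lcl (~` V) V nV Vl.
Qed.

(** * Energies of the approximate heat flow and their dissipation *)

Section Lyapunov.
Context {R : realType} {X : finType} (a b : R) (q : R -> X -> X -> R).
Context (p : R -> X -> R) (c k K B : R) (rho : R -> X -> R).
Hypothesis ab : a < b.
Hypothesis q_ge0 : forall t x y, a < t < b -> x != y -> 0 <= q t x y.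
Hypothesis c_gt0 : 0 < c.
Hypothesis k_ge0 : 0 <= k.
Hypothesis K_ge0 : 0 <= K.
Hypothesis B_ge0 : 0 <= B.
Hypothesis p_bnd : forall t x, a < t < b -> c <= p t x <= 1.
Hypothesis p_lip : forall s t x, a < s < b -> a < t < b ->
  `|p s x - p t x| <= k * `|s - t|.
Hypothesis balance : forall t x y, a < t < b -> q t x y * p t x = q t y x * p t y.
Hypothesis rho_heat : approx_heat a b q K rho.
Hypothesis rho_bnd : forall t x, a < t < b -> `|rho t x| <= B.

(** Stands for a bounded second derivative on [[- B, B]]; in terms of the Taylor remainder, products
    with [u - r] are covered by algebra alone. A single [L] bounds the remainder, the function and
    its derivative. *)
Record quad_smooth (phi dphi : R -> R) (L : R) : Prop := QuadSmooth {
  qs_cont : continuous phi;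
  qs_ge0 : 0 <= L;
  qs_taylor : forall u v, `|u| <= B -> `|v| <= B ->
    `|phi v - phi u - dphi u * (v - u)| <= L * (v - u) ^+ 2;
  qs_bnd : forall u, `|u| <= B -> `|phi u| <= L;
  qs_dbnd : forall u, `|u| <= B -> `|dphi u| <= L }.

Lemma quad_smooth_cst r : quad_smooth (fun=> r) (fun=> 0) `|r|.
Proof.
split=> //; first by move=> u; exact: cvg_cst.
  by move=> u v _ _; rewrite subrr mul0r subr0 normr0 mulr_ge0// sqr_ge0.
by move=> u _; rewrite normr0.
Qed.

Lemma quad_smoothM phi dphi L r : quad_smooth phi dphi L ->
  exists dpsi L', quad_smooth (fun u => phi u * (u - r)) dpsi L'.
Proof.
move=> [pc L0 pt pb pd].
exists (fun u => dphi u * (u - r) + phi u), (L * (B + `|r|) + L).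
have Br u : `|u| <= B -> `|u - r| <= B + `|r|.
  by move=> uB; rewrite (le_trans (ler_normB _ _))// lerD.
have M0 : 0 <= B + `|r| by rewrite addr_ge0.
split.
- move=> u; apply: cvgM; first exact: pc.
  by apply: cvgB; [exact: cvg_id|exact: cvg_cst].
- by rewrite addr_ge0// mulr_ge0.
- move=> u v uB vB.
  have -> : phi v * (v - r) - phi u * (u - r) - (dphi u * (u - r) + phi u) * (v - u) =
    (phi v - phi u - dphi u * (v - u)) * (v - r) + dphi u * (v - u) ^+ 2 by ring.
  rewrite (le_trans (ler_normD _ _))// [leRHS]mulrDl lerD//.
    by rewrite normrM mulrAC ler_pM// ?pt// Br.
  by rewrite normrM (ger0_norm (sqr_ge0 _)) ler_wpM2r ?sqr_ge0// pd.
- move=> u uB; rewrite normrM (le_trans (ler_pM _ _ (pb u uB) (Br u uB)))//.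
  by rewrite lerDl.
- move=> u uB; rewrite (le_trans (ler_normD _ _))// lerD ?pb//.
  by rewrite normrM ler_pM ?pd ?Br.
Qed.

Lemma quad_smooth_prod (s : seq R) :
  exists dphi L, quad_smooth (fun u => \prod_(r <- s) (u - r) ^+ 2) dphi L.
Proof.
elim: s => [|r s [d [L H]]].
  exists (fun=> 0), `|1|; have := quad_smooth_cst 1.
  by congr quad_smooth; apply/funext => u; rewrite big_nil.
have [d1 [L1 H1]] := quad_smoothM r H; have [d2 [L2 H2]] := quad_smoothM r H1.
exists d2, L2; move: H2; congr quad_smooth; apply/funext => u.
by rewrite big_cons; ring.
Qed.

(** The constant adds up the bounds for the value, the derivative and the remainder. *)
Lemma quad_smooth_sqr : quad_smooth (fun u => u ^+ 2) (fun u => 2 * u) (B ^+ 2 + 2 * B + 1).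
Proof.
have B20 : 0 <= B ^+ 2 by apply: sqr_ge0.
have B0 := B_ge0.
split.
- by move=> u; apply: exprn_continuous.
- lra.
- move=> u v _ _; have -> : v ^+ 2 - u ^+ 2 - 2 * u * (v - u) = (v - u) ^+ 2 by ring.
  by rewrite (ger0_norm (sqr_ge0 _)) ler_peMl ?sqr_ge0//; lra.
- move=> u uB; rewrite normrX; have : `|u| ^+ 2 <= B ^+ 2 by rewrite ler_pXn2r ?nnegrE.
  lra.
- by move=> u uB; rewrite normrM ger0_norm//; lra.
Qed.

Lemma quad_smoothDZ phi dphi L psi dpsi L' r : 0 <= r ->
  quad_smooth phi dphi L -> quad_smooth psi dpsi L' ->
  quad_smooth (fun u => phi u + r * psi u) (fun u => dphi u + r * dpsi u) (L + r * L').
Proof.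
move=> r0 [pc L0 pt pb pd] [qc L'0 qt qb qd]; split.
- move=> u; apply: cvgD; first exact: pc.
  by apply: cvgM; [exact: cvg_cst|exact: qc].
- by rewrite addr_ge0// mulr_ge0.
- move=> u v uB vB.
  have -> : phi v + r * psi v - (phi u + r * psi u) - (dphi u + r * dpsi u) * (v - u) =
    (phi v - phi u - dphi u * (v - u)) + r * (psi v - psi u - dpsi u * (v - u)) by ring.
  rewrite (le_trans (ler_normD _ _))// [leRHS]mulrDl lerD ?pt//.
  by rewrite normrM ger0_norm// -mulrA ler_wpM2l ?qt.
- move=> u uB; rewrite (le_trans (ler_normD _ _))// lerD ?pb//.
  by rewrite normrM ger0_norm// ler_wpM2l ?qb.
- move=> u uB; rewrite (le_trans (ler_normD _ _))// lerD ?pd//.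
  by rewrite normrM ger0_norm// ler_wpM2l ?qd.
Qed.

Definition energy (phi : R -> R) t := \sum_x p t x * phi (rho t x).

(** Twice the Dirichlet form of [rho t] and [dphi (rho t)], whence the divisions by 2 below. *)
Definition dissipation (dphi : R -> R) t :=
  \sum_x \sum_y p t x * q t x y * ((rho t x - rho t y) * (dphi (rho t x) - dphi (rho t y))).

Lemma energy_continuous phi : continuous phi ->
  forall t, a < t < b -> {for t, continuous (energy phi)}.
Proof.
move=> pc t tab; apply: cvg_bigsum => x _; apply: cvgM.
  apply: (lipschitz_continuous_oo k_ge0 _ tab) => s u sab uab; exact: p_lip.
exact: (continuous_comp (rho_heat.1 t x tab) (pc _)).
Qed.

Lemma energy_bnd phi dphi L : quad_smooth phi dphi L ->
  forall t, a < t < b -> `|energy phi t| <= #|X|%:R * L.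
Proof.
have c0 := c_gt0; move=> pq t tab; rewrite (le_trans (ler_norm_sum _ _ _))//.
have -> : #|X|%:R * L = \sum_(x : X) L by rewrite sumr_const mulr_natl.
apply: ler_sum => x _; have /andP[cp p1] := p_bnd x tab.
rewrite normrM ger0_norm; last by lra.
have := qs_bnd pq (rho_bnd x tab); have := normr_ge0 (phi (rho t x)).
by move=> ? ?; apply: le_trans (ler_wpM2r _ p1) _; rewrite ?mul1r.
Qed.

(** Summation by parts: detailed balance allows [x] and [y] to be exchanged in [S], and adding both
    forms of [S] produces the product of differences. *)
Lemma dissipationE dphi t : a < t < b ->
  \sum_x p t x * (dphi (rho t x) * laplacian (q t) (rho t) x) = - (dissipation dphi t / 2).
Proof.
move=> tab; pose S := \sum_x \sum_y p t x * q t x y * (dphi (rho t x) * (rho t y - rho t x)).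
have SE : S = \sum_x p t x * (dphi (rho t x) * laplacian (q t) (rho t) x).
  apply: eq_bigr => x _; rewrite /laplacian !mulr_sumr; apply: eq_bigr => y _; ring.
have S' : S = \sum_x \sum_y p t x * q t x y * (dphi (rho t y) * (rho t x - rho t y)).
  rewrite /S exchange_big; apply: eq_bigr => y _; apply: eq_bigr => x _.
  by rewrite [p t x * _]mulrC balance// [q t y x * _]mulrC.
have : S + S = - dissipation dphi t.
  rewrite {2}S' /S /dissipation -big_split/= -sumrN; apply: eq_bigr => x _.
  rewrite -big_split/= -sumrN; apply: eq_bigr => y _; ring.
rewrite -SE; lra.
Qed.

(** [K1] does not depend on [t], although the rates are unbounded. In [K0], the term [k * L] comes
    from the variation of [p], [L * K] from the error in the heat equation, and [L] from the Taylor
    remainder. *)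
Lemma energy_step phi dphi L : quad_smooth phi dphi L ->
  exists2 K1, 0 <= K1 & forall t, a < t < b -> \forall u \near t^'+,
    energy phi u <= energy phi t + (K1 - dissipation dphi t / 2) * (u - t).
Proof.
have c0 := c_gt0; move=> pq; have L0 := qs_ge0 pq.
pose K0 := k * L + L * K + L.
have K00 : 0 <= K0 by rewrite !addr_ge0// mulr_ge0.
exists (#|X|%:R * K0) => [|t tab]; first by rewrite mulr_ge0.
have step x : \forall u \near t^'+, p u x * phi (rho u x) <= p t x * phi (rho t x) +
    (K0 + p t x * (dphi (rho t x) * laplacian (q t) (rho t) x)) * (u - t).
  pose l := laplacian (q t) (rho t) x.
  have lK0 : 0 < (`|l| + K) ^+ 2 + 1 by rewrite ltr_wpDl// sqr_ge0.
  near=> u.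
  have tu : t < u by near: u; exact: nbhs_right_gt.
  have ub : u < b by near: u; apply: nbhs_right_lt; lra.
  have uab : a < u < b by lra.
  have ru : `|rho u x - rho t x - (u - t) * l| <= K * (u - t).
    by near: u; exact: (rho_heat.2 t x tab).
  (* The admissible step shrinks as the Laplacian [l] grows; this makes the squared increment of
     [rho] at most [u - t], uniformly in the rates. *)
  have ul : (u - t) * (`|l| + K) ^+ 2 <= 1.
    have : u < t + ((`|l| + K) ^+ 2 + 1)^-1.
      by near: u; apply: nbhs_right_lt; rewrite ltrDl invr_gt0.
    move=> ?; apply: (@le_trans _ _ (((`|l| + K) ^+ 2 + 1)^-1 * (`|l| + K) ^+ 2)).
      by rewrite ler_wpM2r ?sqr_ge0//; lra.
    by rewrite mulrC ler_pdivrMr//; lra.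
  set r := rho u x - rho t x in ru.
  have r2 : r ^+ 2 <= u - t.
    have rl : `|r| <= (u - t) * (`|l| + K).
      have -> : r = (r - (u - t) * l) + (u - t) * l by ring.
      have h : `|(u - t) * l| = (u - t) * `|l| by rewrite normrM gtr0_norm//; lra.
      rewrite (le_trans (ler_normD _ _))// h; lra.
    rewrite -real_normK ?num_real//.
    apply: (@le_trans _ _ (((u - t) * (`|l| + K)) ^+ 2)).
      by rewrite ler_pXn2r ?nnegrE// (le_trans _ rl).
    rewrite exprMn expr2 -mulrA ler_piMr//; lra.
  have t1 : (p u x - p t x) * phi (rho u x) <= k * L * (u - t).
    rewrite (le_trans (ler_norm _))// normrM mulrAC ler_pM//.
      by rewrite (le_trans (p_lip _ _ _))// gtr0_norm//; lra.
    exact: (qs_bnd pq (rho_bnd x uab)).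
  have t2 : phi (rho u x) - phi (rho t x) <= (dphi (rho t x) * l) * (u - t) + (L * K + L) * (u - t).
    have := qs_taylor pq (rho_bnd x tab) (rho_bnd x uab); rewrite -/r => H.
    have {}H : phi (rho u x) - phi (rho t x) <= dphi (rho t x) * r + L * r ^+ 2.
      by have := le_trans (ler_norm _) H; lra.
    have h1 : dphi (rho t x) * (r - (u - t) * l) <= L * (K * (u - t)).
      rewrite (le_trans (ler_norm _))// normrM ler_pM//.
      exact: (qs_dbnd pq (rho_bnd x tab)).
    have h2 : L * r ^+ 2 <= L * (u - t) by rewrite ler_wpM2l.
    lra.
  have /andP[cp p1] := p_bnd x tab.
  have t3 : p t x * (phi (rho u x) - phi (rho t x)) <=
      p t x * ((dphi (rho t x) * l) * (u - t)) + (L * K + L) * (u - t).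
    apply: le_trans (ler_wpM2l _ t2) _; first lra.
    rewrite mulrDr lerD2l ler_piMl//.
    by apply: mulr_ge0; [rewrite addr_ge0// mulr_ge0|lra].
  rewrite /K0 -/l; lra.
move: step => /filter_forall; apply: filterS => u step_u.
rewrite /energy; apply: le_trans (ler_sum _ (fun x _ => step_u x)) _.
rewrite big_split/= lerD2l -mulr_suml big_split/= sumr_const dissipationE//.
by rewrite mulr_natl.
Unshelve. all: by end_near. Qed.

Lemma dissipation_ge0 dphi t : a < t < b ->
  (forall u v, `|u| <= B -> `|v| <= B -> 0 <= (u - v) * (dphi u - dphi v)) ->
  0 <= dissipation dphi t.
Proof.
have c0 := c_gt0; move=> tab dm; apply: sumr_ge0 => x _; apply: sumr_ge0 => y _.
have [->|xy] := eqVneq x y; first by rewrite !subrr mul0r mulr0.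
have /andP[cp _] := p_bnd x tab.
apply: mulr_ge0; last by apply: dm; exact: rho_bnd.
by apply: mulr_ge0; [lra|exact: q_ge0].
Qed.

(** Monotonicity of [dphi] makes the dissipation nonnegative, so the energy minus [K1 * t] is
    nonincreasing and bounded below. *)
Lemma convex_energy_cvg phi dphi L : quad_smooth phi dphi L ->
  (forall u v, `|u| <= B -> `|v| <= B -> 0 <= (u - v) * (dphi u - dphi v)) ->
  cvg (energy phi t @[t --> b^'-]).
Proof.
move=> pq dm; have [K1 K10 step] := energy_step pq.
have dini s t : a < s -> s <= t -> t < b ->
    energy phi t <= energy phi s + K1 * (t - s).
  apply: (@dini_le _ _ a b).
    by move=> u; apply: energy_continuous; exact: qs_cont pq.
  move=> u uab e e0; have tu : \forall v \near u^'+, u < v by exact: nbhs_right_gt.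
  apply: filterS2 tu (step u uab) => v uv; have := dissipation_ge0 uab dm => d0 H.
  apply: le_trans H _; rewrite lerD2l ler_wpM2r//; lra.
have -> : energy phi = (fun t => energy phi t - K1 * t) \+ (fun t => K1 * t).
  by apply/funext => t /=; ring.
apply: is_cvgD.
  apply: (@nonincreasing_cvg_left _ _ a b (- (#|X|%:R * L) - K1 * b)) => //.
    by move=> s t as_ st tb; have := dini s t as_ st tb; lra.
  move=> t tab; have := energy_bnd pq tab; rewrite ler_norml => /andP[h _].
  have : K1 * t <= K1 * b by rewrite ler_wpM2l//; lra.
  lra.
apply: (cvgP (K1 * b)); apply: cvgM; first exact: cvg_cst.
by apply: cvg_at_left_filter; exact: cvg_id.
Qed.

(* [phi + L u^2] and [L u^2] are both convex on [-B, B]. *)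
Lemma energy_cvg phi dphi L : quad_smooth phi dphi L ->
  cvg (energy phi t @[t --> b^'-]).
Proof.
move=> pq; have L0 := qs_ge0 pq; have sq := quad_smooth_sqr.
have -> : energy phi = (fun t => energy (fun u => phi u + L * u ^+ 2) t) \-
    (fun t => L * energy (fun u => u ^+ 2) t).
  apply/funext => t /=; rewrite /energy mulr_sumr -sumrB; apply: eq_bigr => x _; ring.
apply: is_cvgB.
  apply: (convex_energy_cvg (quad_smoothDZ L0 pq sq)) => u v uB vB.
  (* Adding the two Taylor bounds shows that [dphi] decreases with slope at most [2 * L], which the
     derivative of [L * u ^+ 2] compensates. *)
  have := qs_taylor pq uB vB; have := qs_taylor pq vB uB.
  rewrite !ler_norml => /andP[h1 _] /andP[h2 _].
  have : (u - v) ^+ 2 = (v - u) ^+ 2 by ring.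
  nra.
apply: is_cvgM; first exact: is_cvg_cst.
apply: (convex_energy_cvg sq) => u v _ _.
have -> : (u - v) * (2 * u - 2 * v) = 2 * (u - v) ^+ 2 by ring.
by rewrite mulr_ge0// sqr_ge0.
Qed.

(* The limits of all the energies determine the limit law of [rho t] under
   [p t], which has finite support; [rho t x] has to accumulate on this
   support, and being continuous it converges. *)
Lemma approx_heat_cvg (pl : X -> R) :
  (forall x, p t x @[t --> b^'-] --> pl x) ->
  forall x, cvg (rho t x @[t --> b^'-]).
Proof.
have ab' := ab; have c0 := c_gt0; move=> ppl y; have [U [UU bU]] := ultraFilterLemma (at_left_proper_filter b).
have nab := near_left_oo ab.
have lex x : exists l : R, rho t x @[t --> U] --> l.
  apply: (@ultra_bounded_cvg _ _ U _ B); apply: bU.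
  by apply: filterS nab => t tab; exact: rho_bnd.
have [l lP] := choice lex.
pose s := [seq l x | x <- enum X].
have [dphi [L pq]] := quad_smooth_prod s.
(* [phi] vanishes at every limit along [U], so its energy tends to 0 along [U]. The energy converges
   at [b], hence its limit there is 0 too. *)
set phi := (fun u => \prod_(r <- s) (u - r) ^+ 2) in pq.
have phil x : phi (l x) = 0.
  rewrite /phi /s big_map (bigD1_seq x)/= ?mem_enum ?enum_uniq//.
  by rewrite subrr expr0n mul0r.
have E0 : energy phi t @[t --> b^'-] --> (0 : R).
  have /cvg_ex[e ee] := energy_cvg pq.
  have eU : energy phi t @[t --> U] --> e by apply: cvg_trans ee; exact: cvg_app.
  have : energy phi t @[t --> U] --> \sum_x pl x * phi (l x).
    apply: cvg_bigsum => x _; apply: cvgM.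
      by apply: cvg_trans (ppl x); exact: cvg_app.
    by apply: (cvg_comp _ _ (lP x)); exact: (qs_cont pq).
  rewrite big1; last by move=> x _; rewrite phil mulr0.
  by move=> /(cvg_unique _ eU) => H; rewrite -H.
have phi0 u : 0 <= phi u by apply: prodr_ge0 => r _; exact: sqr_ge0.
(* All terms of the energy are nonnegative and [p >= c], so a single term is at most the energy
   divided by [c]. *)
have phiy : phi (rho t y) @[t --> b^'-] --> (0 : R).
  have E0c : energy phi t / c @[t --> b^'-] --> (0 : R).
    by rewrite -(mul0r c^-1); apply: cvgM => //; exact: cvg_cst.
  apply: (squeeze_cvgr _ (cvg_cst 0) E0c).
  apply: filterS nab => t tab; rewrite phi0/= ler_pdivlMr//.
  have pt x : 0 <= p t x by have /andP[? _] := p_bnd x tab; lra.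
  rewrite /energy (bigD1 y)//= mulrC -[leLHS]addr0 lerD//.
    by rewrite ler_wpM2r//; have /andP[] := p_bnd y tab.
  by apply: sumr_ge0 => x _; rewrite mulr_ge0.
apply: (cvgP (l y)); apply: (cvg_left_of_finite_cluster ab _ phiy).
  by move=> t; exact: rho_heat.1.
move=> e d e0 db.
have : U [set t | d < t < b /\ `|rho t y - l y| < e].
  apply: filterI.
    by apply: bU; apply/near_leftP; exists (b - d) => [|u ?]; lra.
  by have /cvgrPdist_lt/(_ e e0) := lP y; apply: filterS => t; rewrite distrC.
by move=> /filter_ex[t [? ?]]; exists t.
Qed.

(** As long as [rho t x] and [rho t y] stay apart, half the dissipation is at least
    [c * d * q t x y]. A bounded energy that grows at rate at most [K1] can dissipate only a finite
    amount. *)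
Lemma dissipated_rate_bounded_primitive x y d :
  (forall t, a < t < b -> {for t, continuous (fun t => q t x y)}) -> x != y ->
  0 < d -> (forall t, a < t < b -> d <= (rho t x - rho t y) ^+ 2) ->
  bounded_primitive (fun t => q t x y) a b.
Proof.
have ab' := ab; have c0 := c_gt0; have B0 := B_ge0; move=> qc xy d0 rd; have sq := quad_smooth_sqr.
have [K1 K10 step] := energy_step sq.
have mab : a < (a + b) / 2 < b by lra.
have [G [_ dG]] := primitive_exists mab qc.
have cd0 : 0 < c * d by rewrite mulr_gt0.
have diss t : a < t < b -> c * d * q t x y <= dissipation (fun u => 2 * u) t / 2.
  move=> tab.
  have Dp u v : 0 <= p t u * q t u v * ((rho t u - rho t v) * (2 * rho t u - 2 * rho t v)).
    have [->|uv] := eqVneq u v; first by rewrite !subrr mul0r mulr0.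
    have /andP[cp _] := p_bnd u tab.
    have -> : (rho t u - rho t v) * (2 * rho t u - 2 * rho t v) =
      2 * (rho t u - rho t v) ^+ 2 by ring.
    apply: mulr_ge0; last by rewrite mulr_ge0// sqr_ge0.
    by apply: mulr_ge0; [lra|exact: q_ge0].
  rewrite ler_pdivlMr// /dissipation (bigD1 x)//= (bigD1 y)//=.
  rewrite -[leLHS]addr0 lerD//; last first.
    by apply: sumr_ge0 => u _; apply: sumr_ge0.
  rewrite -[leLHS]addr0 lerD//; last by apply: sumr_ge0.
  have /andP[cp _] := p_bnd x tab.
  have q0 := q_ge0 tab xy.
  have -> : p t x * q t x y * ((rho t x - rho t y) * (2 * rho t x - 2 * rho t y)) =
    p t x * (rho t x - rho t y) ^+ 2 * q t x y * 2 by ring.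
  apply: ler_wpM2r => //; apply: ler_wpM2r => //.
  by apply: ler_pM => //; [lra|lra|exact: rd].
(* The dissipated energy is added back, and the sum still grows at rate at most [K1]. *)
pose F t := energy (fun u => u ^+ 2) t + c * d * G t.
have Fdini s t : a < s -> s <= t -> t < b -> F t <= F s + K1 * (t - s).
  apply: (@dini_le _ _ a b).
    move=> u uab; apply: cvgD; first exact: (energy_continuous (qs_cont sq)).
    by apply: cvgM; [exact: cvg_cst|exact: is_derive_continuous (dG u uab)].
  move=> u uab e e0; have tu : \forall v \near u^'+, u < v by exact: nbhs_right_gt.
  have ecd : 0 < e / (c * d) by rewrite divr_gt0.
  have Gu := is_derive_near_right (dG u uab) ecd.
  apply: filterS3 tu (step u uab) Gu => v uv sv.
  rewrite ler_norml => /andP[_ Gv].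
  have {}Gv : c * d * (G v - G u - (v - u) * q u x y) <= e * (v - u).
    have -> : e * (v - u) = c * d * (e / (c * d) * (v - u)) by field; rewrite !gt_eqF//; lra.
    by rewrite ler_pM2l.
  have : 0 <= (dissipation (fun u => 2 * u) u / 2 - c * d * q u x y) * (v - u).
    by rewrite mulr_ge0 ?subr_ge0 ?diss//; lra.
  rewrite /F; lra.
exists G, ((2 * (#|X|%:R * (B ^+ 2 + 2 * B + 1)) + K1 * (b - a)) / (c * d)).
split=> // s t as_ st tb; rewrite ler_pdivlMr// mulrC mulrBr.
have := Fdini s t as_ st tb; rewrite /F.
have sab : a < s < b by lra.
have tab : a < t < b by lra.
have := energy_bnd sq sab; have := energy_bnd sq tab; rewrite !ler_norml.
have : K1 * (t - s) <= K1 * (b - a) by rewrite ler_wpM2l//; lra.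
lra.
Qed.

End Lyapunov.

(** * Reversible rates on one interval *)

Lemma fin_lower_bound {R : realType} (X : finType) (f : X -> R) :
  (forall x, 0 < f x) -> exists2 c, 0 < c & forall x, c <= f x.
Proof.
move=> f0; have [x|x K K' KK' fK|K K0 KP] := @fin_upper_bound R X (fun x K => (f x)^-1 <= K).
- by exists (f x)^-1.
- exact: le_trans KK'.
- exists (K + 1)^-1 => [|x]; first by rewrite invr_gt0; lra.
  by rewrite -(invrK (f x)) lef_pV2 ?posrE ?invr_gt0//; [have := KP x|]; lra.
Qed.

Lemma ler_norm_bigsum {R : realType} (X : finType) (f : X -> R) x :
  `|f x| <= \sum_y `|f y|.
Proof. by rewrite (bigD1 x)//= lerDl sumr_ge0. Qed.

(** * Solutions issued from a singular end *)

Section LinearStart.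
Context {R : realType} {X : finType} (a b : R) (A : R -> X -> X -> R).
Hypothesis ab : a < b.
Hypothesis A_cont : forall x y t, a < t < b -> {for t, continuous (fun u => A u x y)}.

Lemma linear_solutionB v w : linear_solution a b A v -> linear_solution a b A w ->
  linear_solution a b A (fun t x => v t x - w t x).
Proof.
move=> vs ws t x tab; rewrite -linmapB.
have := vs t x tab; have := ws t x tab; move=> ? ?; exact: is_deriveB.
Qed.

(* The solution issued from the singular time [a] is the limit, as [s]
   decreases to [a], of the solutions issued from [v0 s] at time [s]. *)
Lemma linear_start_exists (v0 : R -> X -> R) C0 C b' : 0 <= C0 -> 0 <= C -> a < b' <= b ->
  (forall v, linear_solution a b A v -> forall s t M, a < s -> s <= t -> t < b ->
    (forall x, `|v s x| <= M) -> forall x, `|v t x| <= C0 * M) ->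
  (forall v, linear_solution a b A v -> forall s t, a < s -> s <= t -> t < b' ->
    (forall x, v s x = v0 s x) -> forall x, `|v t x - v0 t x| <= C * (t - s)) ->
  exists2 v, linear_solution a b A v &
    forall t x, a < t < b' -> `|v t x - v0 t x| <= C * (t - a).
Proof.
move=> C00 C_0 abb' stab drift; have ab0 := ab.
pose h := b' - a.
have h0 : 0 < h by rewrite /h; lra.
pose e n : R := h / n.+2%:R.
have e0 n : 0 < e n by rewrite divr_gt0.
have eh n : e n < h by rewrite ltr_pdivrMr// ltr_pMr// ltr1n.
have eE m n : (m <= n)%N -> e n <= e m.
  by move=> mn; rewrite ler_pM2l// lef_pV2 ?posrE// ler_nat.
have e_small r : 0 < r -> exists N, forall n, (N <= n)%N -> e n <= r.
  move=> r0; exists (Num.truncn (h / r)) => n Nn; apply: le_trans (eE _ _ Nn) _.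
  rewrite ler_pdivrMr// mulrC -ler_pdivrMr//.
  by have := truncnS_gt (h / r) => /ltW/le_trans; apply; rewrite ler_nat.
have sol n : exists v, linear_solution a b A v /\ forall x, v (a + e n) x = v0 (a + e n) x.
  have [|v ? ?] := @linear_solution_exists R X a b A ab A_cont (a + e n) (v0 (a + e n)).
    by have := e0 n; have := eh n; rewrite /h; lra.
  by exists v.
have [v_ v_P] := choice sol.
(* At time [a + e n] the solution [v_ n] equals [v0], while [v_ m], started earlier, has drifted
   from it by at most [C * e n]; stability carries this to all later times. *)
have cmp m n t x : (n <= m)%N -> a + e n <= t < b ->
    `|v_ m t x - v_ n t x| <= C0 * (C * e n).
  move=> nm tn; have [vm vms] := v_P m; have [vn vns] := v_P n.
  apply: (stab _ (linear_solutionB vm vn) (a + e n) t) => [|||y]; [|lra|lra|].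
    by have := e0 n; lra.
  have := eE _ _ nm; have := e0 m; have := eh n; rewrite /h vns => ? ? ?.
  apply: le_trans (drift _ vm (a + e m) (a + e n) _ _ _ vms y) _; [lra|lra|lra|].
  by rewrite ler_wpM2l//; lra.
have [v vv] : exists v, loc_unif_cvg a b v_ v.
  apply: loc_unif_cauchy => s t as_ tb r r0.
  have D0 : 0 < C0 * C + 1 by rewrite ltr_wpDl// mulr_ge0.
  have [N1 N1P] := e_small (s - a) ltac:(lra).
  have [N2 N2P] := e_small (r / (C0 * C + 1)) ltac:(by rewrite divr_gt0).
  exists (maxn N1 N2) => n m; rewrite !geq_max => /andP[N1n N2n] /andP[N1m N2m] u sut x.
  have main i j : (j <= i)%N -> (N1 <= j)%N -> (N2 <= j)%N -> `|v_ i u x - v_ j u x| <= r.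
    move=> ji N1j N2j; have := N1P j N1j => ?.
    apply: le_trans (cmp i j u x ji _) _; first lra.
    have := N2P j N2j; rewrite ler_pdivlMr// => H; apply: le_trans H.
    by have := e0 j; nra.
  have [nm|mn] := leqP n m; first by rewrite distrC; exact: main.
  by apply: main => //; exact: ltnW.
exists v.
  by apply: (linear_limit ab A_cont _ vv vv) => n t x tab; exact: (v_P n).1.
move=> t x tab; have tab' : a < t < b by lra.
apply: (cvgr_to_le (cvg_norm (cvgB (loc_unif_pointwise vv (x := x) tab') (cvg_cst (v0 t x))))).
have [N NP] := e_small (t - a) ltac:(lra).
exists N => // n /= Nn; have [vn vns] := v_P n; have := NP n Nn; have := e0 n => ? ?.
apply: le_trans (drift _ vn (a + e n) t _ _ _ vns x) _; [lra|lra|lra|].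
by rewrite ler_wpM2l//; lra.
Qed.

End LinearStart.

Section Generators.
Context {R : realType} {X : finType}.
Implicit Types (q : R -> X -> X -> R).

(** The diagonal is written through the off-diagonal rates, which are the ones known to be
    continuous. *)
Definition heat_mx q t x y : R :=
  if y == x then - \sum_(z | z != x) q t x z else q t x y.
Definition dual_mx q t x y : R :=
  if y == x then - \sum_(z | z != x) q t x z else q t y x.

Lemma linmap_heat_mx q t v x : linmap (heat_mx q) t v x = laplacian (q t) v x.
Proof.
rewrite /linmap /laplacian (bigD1 x)//= [RHS](bigD1 x)//= /heat_mx eqxx subrr mul0r add0r.
rewrite mulNr mulr_suml -sumrN -big_split/=; apply: eq_bigr => y /negPf ->; ring.
Qed.

Lemma linmap_dual_mx q t v x : linmap (dual_mx q) t v x = dual_laplacian (q t) v x.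
Proof.
rewrite /linmap /dual_laplacian (bigD1 x)//= /dual_mx eqxx.
rewrite mulNr mulr_suml -sumrN -big_split/=; apply: eq_bigr => y /negPf ->; ring.
Qed.

Lemma heat_flowE a b q v : heat_flow a b q v <-> linear_solution a b (heat_mx q) v.
Proof. by split=> H t x tab; have := H t x tab; rewrite linmap_heat_mx. Qed.

Lemma dual_flowE a b q w : dual_flow a b q w <-> linear_solution a b (dual_mx q) w.
Proof. by split=> H t x tab; have := H t x tab; rewrite linmap_dual_mx. Qed.

End Generators.

(** The data of one open interval in a form stable under restriction and time reversal, so that the
    dual equation can be run forward. *)
Record reversible {R : realType} {X : finType} (a b : R) (q : R -> X -> X -> R)
    (p : R -> X -> R) (k : R) : Prop := Reversible {
  rev_rate_ge0 : forall t x y, a < t < b -> x != y -> 0 <= q t x y;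
  rev_rate_cont : forall t x y, a < t < b -> x != y -> {for t, continuous (fun u => q u x y)};
  rev_lip_ge0 : 0 <= k;
  rev_prob : forall t x, a < t < b -> 0 < p t x <= 1;
  rev_prob_lip : forall s t x, a < s < b -> a < t < b -> `|p s x - p t x| <= k * `|s - t|;
  rev_balance : forall t x y, a < t < b -> q t x y * p t x = q t y x * p t y }.

Section ReversibleFlow.
Context {R : realType} {X : finType}.
Implicit Types (a b k : R) (q : R -> X -> X -> R) (p : R -> X -> R).

Lemma reversible_sub a b a' b' q p k : a <= a' -> b' <= b ->
  reversible a b q p k -> reversible a' b' q p k.
Proof.
move=> aa bb [H1 H2 H3 H4 H5 H6]; split=> //.
- by move=> t x y tab; apply: H1; lra.
- by move=> t x y tab; apply: H2; lra.
- by move=> t x tab; apply: H4; lra.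
- by move=> s t x sab tab; apply: H5; lra.
- by move=> t x y tab; apply: H6; lra.
Qed.

Lemma heat_flow_sub a b a' b' q v : a <= a' -> b' <= b ->
  heat_flow a b q v -> heat_flow a' b' q v.
Proof. by move=> aa bb H t x tab; apply: H; lra. Qed.

Lemma dual_flow_sub a b a' b' q v : a <= a' -> b' <= b ->
  dual_flow a b q v -> dual_flow a' b' q v.
Proof. by move=> aa bb H t x tab; apply: H; lra. Qed.

Section Fixed.
Context (a b k : R) (q : R -> X -> X -> R) (p : R -> X -> R).
Hypothesis ab : a < b.
Hypothesis rev : reversible a b q p k.

Lemma diag_cont x t : a < t < b ->
  {for t, continuous (fun u => - \sum_(z | z != x) q u x z)}.
Proof.
move=> tab; apply: cvgN; apply: cvg_bigsum => z zx.
by apply: (rev_rate_cont rev) => //; rewrite eq_sym.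
Qed.

Lemma heat_mx_cont x y t : a < t < b -> {for t, continuous (fun u => heat_mx q u x y)}.
Proof.
move=> tab; rewrite /heat_mx; case: eqVneq => yx; first exact: diag_cont.
by apply: (rev_rate_cont rev) => //; rewrite eq_sym.
Qed.

Lemma dual_mx_cont x y t : a < t < b -> {for t, continuous (fun u => dual_mx q u x y)}.
Proof.
move=> tab; rewrite /dual_mx; case: eqVneq => yx; first exact: diag_cont.
exact: (rev_rate_cont rev).
Qed.

Lemma heat_flow_exists s v0 : a < s < b ->
  exists2 v, heat_flow a b q v & forall x, v s x = v0 x.
Proof.
move=> sab; have [v vs v0s] := linear_solution_exists ab heat_mx_cont v0 sab.
by exists v => //; apply/heat_flowE.
Qed.

Lemma dual_flow_exists s v0 : a < s < b ->
  exists2 v, dual_flow a b q v & forall x, v s x = v0 x.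
Proof.
move=> sab; have [v vs v0s] := linear_solution_exists ab dual_mx_cont v0 sab.
by exists v => //; apply/dual_flowE.
Qed.

Lemma heat_flowB v w : heat_flow a b q v -> heat_flow a b q w ->
  heat_flow a b q (fun t x => v t x - w t x).
Proof. by move=> /heat_flowE vs /heat_flowE ws; apply/heat_flowE; exact: linear_solutionB. Qed.

Lemma dual_flowB v w : dual_flow a b q v -> dual_flow a b q w ->
  dual_flow a b q (fun t x => v t x - w t x).
Proof. by move=> /dual_flowE vs /dual_flowE ws; apply/dual_flowE; exact: linear_solutionB. Qed.

Lemma dual_flow_bound w : dual_flow a b q w -> forall s t, a < s -> s <= t -> t < b ->
  forall x, `|w t x| <= \sum_y `|w s y|.
Proof.
move=> wd s t as_ st tb x; apply: le_trans (ler_norm_bigsum _ _) _.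
exact: (dual_flow_l1 (rev_rate_ge0 rev) wd).
Qed.

Lemma heat_flow_unique v w : heat_flow a b q v -> heat_flow a b q w ->
  (forall x, v t x - w t x @[t --> a^'+] --> (0 : R)) ->
  forall t x, a < t < b -> v t x = w t x.
Proof.
move=> vh wh vw t x tab; apply/eqP; rewrite -subr_eq0 -normr_le0.
apply/ler_addgt0Pr => e e0; rewrite add0r.
have nvw y : \forall s \near a^'+, `|v s y - w s y| <= e.
  have /cvgrPdist_le/(_ e e0) := vw y.
  by apply: filterS => s; rewrite sub0r normrN.
have [s [sw as_ st]] : exists s, [/\ forall y, `|v s y - w s y| <= e, a < s & s < t].
  have at_ : a < t by lra.
  have [b' ab' b'P] := near_right_interval at_ (filter_forall _ nvw).
  by exists ((a + b') / 2); split; [apply: b'P|..]; lra.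
apply: (@heat_flow_sup _ _ a b q (rev_rate_ge0 rev) _ e (heat_flowB vh wh) s t) => //; lra.
Qed.

Lemma dual_flow_unique v w : dual_flow a b q v -> dual_flow a b q w ->
  (forall x, v t x - w t x @[t --> a^'+] --> (0 : R)) ->
  forall t x, a < t < b -> v t x = w t x.
Proof.
move=> vh wh vw t x tab; apply/eqP; rewrite -subr_eq0 -normr_le0.
have cv : \sum_y `|v s y - w s y| @[s --> a^'+] --> \sum_(y : X) `|0 : R|.
  by apply: cvg_bigsum => y _; apply: cvg_norm.
move: cv; rewrite normr0 big1// => cv; apply: (cvgr_to_ge cv).
apply/near_rightP; exists (t - a) => [|s sat]; first lra.
by apply: (dual_flow_bound (dual_flowB vh wh)); lra.
Qed.

(** The drift estimates hold on open intervals that contain the starting time [s], whereas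
    contraction bounds the solution only from [s] on. Continuity extends the bound a little to the
    left at the price of 1. *)
Lemma extend_bound (w : R -> X -> R) b' B s : (forall t x, a < t < b -> {for t, continuous (w ^~ x)}) ->
  a < s -> s < b' <= b -> (forall t x, s <= t < b' -> `|w t x| <= B) ->
  exists2 s', a < s' < s & forall t (x : X), s' < t < b' -> `|w t x| <= B + 1.
Proof.
move=> wc as_ sb' wB.
have nb : \forall t \near s^'-, forall x, `|w t x| <= B + 1.
  apply: filter_forall => x.
  have wx : w t x @[t --> s^'-] --> w s x.
    by apply: cvg_at_left_filter; apply: wc; lra.
  have /cvgrPdist_le/(_ 1 ltr01) := wx; apply: filterS => t h.
  have sx : `|w s x| <= B by apply: wB; lra.
  have -> : w t x = w s x - (w s x - w t x) by ring.
  by rewrite (le_trans (ler_normB _ _))// lerD.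
have [s' ss' s'P] := near_left_interval as_ nb.
exists s' => // t x tb; have [ts|st] := ltP t s; first by apply: s'P; lra.
by apply: le_trans (wB t x _) _; lra.
Qed.

Lemma cross_rate_bound (Z : eqType) (pr : X -> Z) b' K M rho :
  a < b' <= b -> 0 <= K -> 0 <= M ->
  (forall t x y, a < t < b' -> pr x != pr y -> q t x y <= K) ->
  forall t x, a < t < b' -> (forall y, `|rho y| <= M) ->
  `|\sum_(y | pr y != pr x) (rho y - rho x) * q t x y| <= #|X|%:R * (2 * M * K).
Proof.
move=> abb' K0 M0 qK t x tab rM; rewrite (le_trans (ler_norm_sum _ _ _))//.
apply: (@le_trans _ _ (\sum_(y | pr y != pr x) (2 * M * K))).
  apply: ler_sum => y yx; have xy : x != y by apply: contraNneq yx => ->.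
  rewrite normrM ler_pM//.
    by rewrite (le_trans (ler_normB _ _))// mulrDl !mul1r lerD.
  rewrite ger0_norm; first by apply: qK => //; rewrite eq_sym.
  by apply: (rev_rate_ge0 rev) => //; lra.
rewrite -mulr_natl sumr_const -[leLHS]mulr_natl ler_wpM2r ?mulr_ge0//.
by rewrite ler_nat max_card.
Qed.

(* Values constant on the fibres of [pr] are the admissible initial values at a
   time where the rates inside the fibres explode. *)
Lemma heat_start_exists (Z : eqType) (pr : X -> Z) (f : Z -> R) b' K : a < b' <= b -> 0 <= K ->
  (forall t x y, a < t < b' -> pr x != pr y -> q t x y <= K) ->
  exists2 v, heat_flow a b q v & forall x, v t x @[t --> a^'+] --> f (pr x).
Proof.
move=> abb' K0 qK.
pose M := \sum_x `|f (pr x)|.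
have M0 : 0 <= M by apply: sumr_ge0.
(* The 1 is the error size with which an exact solution is taken as an approximate one; the rest
   bounds the exchange between fibres for values of size [M + 1]. *)
pose C := 1 + #|X|%:R * (2 * (M + 1) * K).
have C0 : 0 <= C.
  by rewrite addr_ge0// !mulr_ge0// addr_ge0.
have [||v vs vC] := @linear_start_exists _ _ a b (heat_mx q) ab heat_mx_cont
    (fun t x => f (pr x)) 1 C b' ler01 C0 abb' _ _.
- move=> v /heat_flowE vh s t L as_ st tb vL x; rewrite mul1r.
  exact: (heat_flow_sup (rev_rate_ge0 rev) vh as_ st tb vL).
- move=> v /heat_flowE vh s t as_ st tb vs.
  have vM u x : s <= u < b' -> `|v u x| <= M.
    move=> su; apply: (heat_flow_sup (rev_rate_ge0 rev) vh as_) => [||y]; [lra|lra|].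
    by rewrite vs (ler_norm_bigsum (fun y => f (pr y))).
  have vc u x : a < u < b -> {for u, continuous (v ^~ x)}.
    by move=> /vh => /(_ x)/is_derive_continuous.
  have [|s' ss' vM'] := extend_bound vc as_ _ vM; first lra.
  apply: (@approx_heat_drift _ _ s' b' q _ _ pr f 1) => //; try lra.
  + by move=> u x y usb; apply: (rev_rate_ge0 rev); lra.
  + by apply: heat_flow_approx => //; apply: heat_flow_sub vh; lra.
  + move=> u x usb; apply: (cross_rate_bound abb' K0 _ qK); [lra|lra|].
    by move=> y; apply: vM'.
exists v; first by apply/heat_flowE.
move=> x; apply/cvgrPdist_le => e e0; apply/near_rightP.
pose d := Num.min (b' - a) (e / (C + 1)).
have [d1 d2] : d <= b' - a /\ d <= e / (C + 1) by rewrite !ge_min !lexx orbT.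
exists d => [|t td]; first by rewrite lt_min divr_gt0//; lra.
rewrite distrC (le_trans (vC t x _))//; first lra.
apply: (@le_trans _ _ (C * (e / (C + 1)))); first by rewrite ler_wpM2l//; lra.
by rewrite mulrA ler_pdivrMr; nra.
Qed.

(** The approximating solutions start from [f (pr x) * p t x], whose density is constant on fibres;
    the drift estimate applies to the density. *)
Lemma dual_start_exists (Z : eqType) (pr : X -> Z) (f : Z -> R) b' K c (pl : X -> R) :
  a < b' <= b -> 0 <= K -> 0 < c ->
  (forall t x y, a < t < b' -> pr x != pr y -> q t x y <= K) ->
  (forall t x, a < t < b' -> c <= p t x) ->
  (forall x, p t x @[t --> a^'+] --> pl x) ->
  exists2 w, dual_flow a b q w & forall x, w t x @[t --> a^'+] --> f (pr x) * pl x.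
Proof.
move=> abb' K0 c0 qK pc ppl.
have p1 t x : a < t < b -> 0 < p t x <= 1 by move=> tab; exact: (rev_prob rev).
pose M := \sum_x `|f (pr x)|.
have M0 : 0 <= M by apply: sumr_ge0.
have k0 := rev_lip_ge0 rev.
have M1c : 0 <= (M + 1) / c by rewrite divr_ge0 ?addr_ge0// ltW.
pose C := (M + 1) * k / c ^+ 2 + 1 + #|X|%:R * (2 * ((M + 1) / c) * K).
have C0 : 0 <= C.
  apply: addr_ge0; last by apply: mulr_ge0 => //; apply: mulr_ge0 => //; apply: mulr_ge0.
  by apply: addr_ge0 => //; rewrite divr_ge0 ?sqr_ge0// mulr_ge0// addr_ge0.
(* The l1 contraction gives stability in the sup norm up to the factor [#|X|]. *)
have [||w ws wC] := @linear_start_exists _ _ a b (dual_mx q) ab dual_mx_cont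
    (fun t x => f (pr x) * p t x) #|X|%:R C b' (ler0n _ _) C0 abb' _ _.
- move=> w /dual_flowE wh s t L as_ st tb wL x.
  apply: le_trans (dual_flow_bound wh as_ st tb x) _.
  have -> : #|X|%:R * L = \sum_(y : X) L by rewrite sumr_const mulr_natl.
  exact: ler_sum.
- move=> w /dual_flowE wh s t as_ st tb ws x.
  have wM u y : s <= u < b' -> `|w u y| <= M.
    move=> su; apply: le_trans (dual_flow_bound wh as_ _ _ y) _; [lra|lra|].
    apply: ler_sum => z _; rewrite ws normrM ler_piMr//.
    have sab : a < s < b by lra.
    by have pz := p1 s z sab; rewrite gtr0_norm; lra.
  have wc u y : a < u < b -> {for u, continuous (w ^~ y)}.
    by move=> /wh => /(_ y)/is_derive_continuous.
  have [|s' ss' wM'] := extend_bound wc as_ _ wM; first lra.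
  have p0 u y : a < u < b -> p u y != 0 by move=> /(p1 u y) h; rewrite gt_eqF//; lra.
  have ap : approx_heat s' b' q ((M + 1) * k / c ^+ 2 + 1) (fun t x => w t x / p t x).
    apply: (@dual_flow_approx _ _ s' b' q) => //.
    + by apply: dual_flow_sub wh; lra.
    + by move=> u y usb; apply: pc; lra.
    + by move=> u v y usb vsb; apply: (rev_prob_lip rev); lra.
    + by move=> u y z usb; apply: (rev_balance rev); lra.
  have drift : `|w t x / p t x - f (pr x)| <= C * (t - s).
    apply: (@approx_heat_drift _ _ s' b' q _ _ pr f _ _ _ ap) => //; try lra.
    + by move=> u y z usb; apply: (rev_rate_ge0 rev); lra.
    + move=> u y usb; apply: (@cross_rate_bound _ pr b' K ((M + 1) / c)
        (fun z => w u z / p u z)) => //; first lra.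
      move=> z; have usb' : a < u < b' by lra.
      have := pc u z usb' => cz.
      rewrite normrM ler_pM//; first exact: wM'.
      by rewrite normfV gtr0_norm ?lef_pV2 ?posrE//; lra.
    + by move=> y; rewrite ws mulfK// p0//; lra.
  have tab : a < t < b by lra.
  have -> : w t x - f (pr x) * p t x = p t x * (w t x / p t x - f (pr x)).
    by field; exact: p0.
  have := p1 t x tab => pt; rewrite normrM gtr0_norm; last by lra.
  by apply: le_trans drift; rewrite ler_piMl//; lra.
exists w; first by apply/dual_flowE.
move=> x; have fpc : f (pr x) * p t x @[t --> a^'+] --> f (pr x) * pl x.
  by apply: cvgM; [exact: cvg_cst|exact: ppl].
have d0 : w t x - f (pr x) * p t x @[t --> a^'+] --> (0 : R).
  apply/cvgrPdist_le => e e0; apply/near_rightP.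
  pose d := Num.min (b' - a) (e / (C + 1)).
  have [d1 d2] : d <= b' - a /\ d <= e / (C + 1) by rewrite !ge_min !lexx orbT.
  exists d => [|t td]; first by rewrite lt_min divr_gt0//; lra.
  rewrite sub0r normrN (le_trans (wC t x _))//; first lra.
  apply: (@le_trans _ _ (C * (e / (C + 1)))); first by rewrite ler_wpM2l//; lra.
  by rewrite mulrA ler_pdivrMr; nra.
have E : \forall t \near a^'+, w t x - f (pr x) * p t x + f (pr x) * p t x = w t x.
  by apply: nearW => t; rewrite subrK.
rewrite -[_ * pl x]add0r.
by apply: cvg_trans (cvgD d0 fpc); exact: near_eq_cvg E.
Qed.

End Fixed.

Lemma near_lower (F : set_system R) {FF : Filter F} (p : R -> X -> R) (pl : X -> R) :
  (forall x, p t x @[t --> F] --> pl x) -> (forall x, 0 < pl x) ->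
  exists2 c, 0 < c & \forall t \near F, forall x, c <= p t x.
Proof.
move=> ppl pl0; have [c c0 cP] := fin_lower_bound pl0.
exists (c / 2); first lra.
by apply: filter_forall => x; apply: (cvgr_ge _ (ppl x)); have := cP x; lra.
Qed.

(** * Limits at an end and their equality across explosive edges *)

Section Ends.
Context (a b k : R) (q : R -> X -> X -> R) (p : R -> X -> R) (pl : X -> R).
Hypothesis ab : a < b.
Hypothesis rev : reversible a b q p k.
Hypothesis pl_gt0 : forall x, 0 < pl x.

Lemma approx_heat_end rho K B : 0 <= K -> 0 <= B ->
  (forall x, p t x @[t --> b^'-] --> pl x) ->
  approx_heat a b q K rho -> (forall t x, a < t < b -> `|rho t x| <= B) ->
  forall x, cvg (rho t x @[t --> b^'-]).
Proof.
move=> K0 B0 ppl rh rB x; have [c c0 npc] := near_lower ppl pl_gt0.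
have [a' aa' pc] := near_left_interval ab npc.
have rev' : reversible a' b q p k by apply: reversible_sub rev; lra.
apply: (@approx_heat_cvg R X a' b q p c k K B rho) => //; try lra.
- exact: rev_rate_ge0 rev'.
- exact: rev_lip_ge0 rev'.
- by move=> t y tb; rewrite pc//=; have := rev_prob rev' y tb; lra.
- exact: rev_prob_lip rev'.
- exact: rev_balance rev'.
- by case: rh => [h1 h2]; split=> t y tb; [apply: h1|apply: h2]; lra.
- by move=> t y tb; apply: rB; lra.
Qed.

(** Different limits would keep [rho t x] and [rho t y] apart near the end, and the dissipation
    bound would make the rate integrable there. A general filter serves [b^'-] for heat flows and
    [a^'+] for dual flows. *)
Lemma explosive_eq (F : set_system R) {FF : ProperFilter F} rho K B (l : X -> R) x y :
  0 <= K -> 0 <= B ->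
  (forall x, p t x @[t --> F] --> pl x) ->
  approx_heat a b q K rho -> (forall t x, a < t < b -> `|rho t x| <= B) ->
  (forall x, rho t x @[t --> F] --> l x) ->
  x != y ->
  (forall P : R -> Prop, (\forall t \near F, P t) -> exists a' b',
     [/\ a <= a', a' < b', b' <= b, forall t, a' < t < b' -> P t &
      ~ bounded_primitive (fun t => q t x y) a' b']) ->
  l x = l y.
Proof.
move=> K0 B0 ppl rh rB rl xy qoo; apply/eqP; rewrite -subr_eq0; apply: contrapT => /negP lxy.
have [c c0 npc] := near_lower ppl pl_gt0.
pose d := (l x - l y) ^+ 2 / 2.
have d0 : 0 < d by rewrite divr_gt0// exprn_even_gt0.
have nd : \forall t \near F, d <= (rho t x - rho t y) ^+ 2.
  have cv : (rho t x - rho t y) ^+ 2 @[t --> F] --> (l x - l y) ^+ 2.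
    by rewrite expr2; under eq_fun do rewrite expr2; apply: cvgM; apply: cvgB; exact: rl.
  by apply: (cvgr_ge _ cv); rewrite /d in d0 *; lra.
have [a' [b' [aa' a'b' b'b pdP]]] := qoo _ (filterI npc nd); apply.
have rev' : reversible a' b' q p k by apply: reversible_sub rev.
apply: (@dissipated_rate_bounded_primitive R X a' b' q p c k K B rho) d0 _ => //.
- exact: rev_rate_ge0 rev'.
- exact: rev_lip_ge0 rev'.
- move=> t z tb; have := rev_prob rev' z tb.
  by have : c <= p t z by [apply: (pdP t tb).1]; lra.
- exact: rev_prob_lip rev'.
- exact: rev_balance rev'.
- by case: rh => [h1 h2]; split=> t z tb; [apply: h1|apply: h2]; lra.
- by move=> t z tb; apply: rB; lra.
- by move=> t tb; exact: (rev_rate_cont rev').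
- by move=> t tb; exact: (pdP t tb).2.
Qed.

End Ends.

Lemma heat_flow_end a b k q p (pl : X -> R) v : a < b -> reversible a b q p k ->
  (forall x, 0 < pl x) -> (forall x, p t x @[t --> b^'-] --> pl x) ->
  heat_flow a b q v ->
  exists2 g : X -> R, forall x, v t x @[t --> b^'-] --> g x &
  forall x y, x != y -> (forall a', a < a' < b ->
     ~ bounded_primitive (fun t => q t x y) a' b) -> g x = g y.
Proof.
move=> ab rev pl0 ppl vh.
pose s := (a + b) / 2.
have sab : a < s < b by rewrite /s; lra.
have [as_ sb] : a < s /\ s < b by lra.
pose B := \sum_x `|v s x|.
have B0 : 0 <= B by apply: sumr_ge0.
have rev' : reversible s b q p k by apply: reversible_sub rev; lra.
have vh' : heat_flow s b q v by apply: heat_flow_sub vh; lra.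
have vB t x : s < t < b -> `|v t x| <= B.
  move=> st; apply: (heat_flow_sup (rev_rate_ge0 rev) vh as_) => [||y]; [lra|lra|].
  exact: ler_norm_bigsum.
have ah := heat_flow_approx vh' ltr01.
have lim_v x : cvg (v t x @[t --> b^'-]).
  exact: (@approx_heat_end s b k q p pl sb rev' pl0 v 1 B ler01 B0 ppl ah vB).
exists (fun x => lim (v t x @[t --> b^'-])) => // x y xy qoo.
apply: (@explosive_eq s b k q p pl rev' pl0 (b^'-) _ v 1 B
  (fun x => lim (v t x @[t --> b^'-])) x y ler01 B0 ppl ah vB lim_v xy) => P nP.
have [a' sa' a'P] := near_left_interval sb nP.
by exists a', b; split=> //; [lra|lra|apply: qoo; lra].
Qed.

Lemma dual_flow_end a b k q p (pl : X -> R) w : a < b -> reversible a b q p k ->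
  (forall x, 0 < pl x) -> (forall x, p t x @[t --> b^'-] --> pl x) ->
  dual_flow a b q w ->
  exists g : X -> R, forall x, w t x @[t --> b^'-] --> g x.
Proof.
move=> ab rev pl0 ppl wd.
have [c c0 npc] := near_lower ppl pl0.
have [a1 a1b pc] := near_left_interval ab npc.
pose s := (a1 + b) / 2.
have s1 : a1 < s < b by rewrite /s; lra.
have sb : s < b by lra.
pose B := \sum_x `|w s x|.
have B0 : 0 <= B by apply: sumr_ge0.
have rev' : reversible s b q p k by apply: reversible_sub rev; lra.
have k0 := rev_lip_ge0 rev.
have wB t x : s < t < b -> `|w t x| <= B.
  by move=> st; apply: (dual_flow_bound rev wd); lra.
have pc' t x : s < t < b -> c <= p t x by move=> st; apply: pc; lra.
have ah : approx_heat s b q (B * k / c ^+ 2 + 1) (fun t x => w t x / p t x).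
  apply: (@dual_flow_approx _ _ s b q) => //.
  - by apply: dual_flow_sub wd; lra.
  - exact: rev_prob_lip rev'.
  - exact: rev_balance rev'.
have rB t x : s < t < b -> `|w t x / p t x| <= B / c.
  move=> st; have := pc' t x st => ptx.
  rewrite normrM ler_pM ?wB// normfV gtr0_norm ?lef_pV2 ?posrE//; lra.
have K0 : 0 <= B * k / c ^+ 2 + 1.
  by rewrite addr_ge0// !mulr_ge0// invr_ge0 sqr_ge0.
have Bc0 : 0 <= B / c by rewrite divr_ge0// ltW.
have lim_r := @approx_heat_end s b k q p pl sb rev' pl0 _ _ _ K0 Bc0 ppl ah rB.
exists (fun x => lim (w t x / p t x @[t --> b^'-]) * pl x) => x.
have E : \forall t \near b^'-, w t x / p t x * p t x = w t x.
  apply/near_leftP; exists (b - s) => [|t tb]; first lra.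
  have st : s < t < b by lra.
  by rewrite mulfVK// gt_eqF//; have := pc' t x st; lra.
by apply: cvg_trans (cvgM (lim_r x) (ppl x)); exact: near_eq_cvg E.
Qed.

Lemma connect_invariant (T : Type) (e : rel X) (f : X -> T) x y :
  (forall u v, e u v -> f u = f v) -> connect e x y -> f x = f y.
Proof.
move=> ef /connectP[s + ->]; elim: s x => [//|z s IH] x /= /andP[xz zs].
by rewrite (ef _ _ xz); exact: IH.
Qed.

(** The limit density [l / pl] agrees across explosive edges, hence on each fibre. So [l] is a
    multiple of the positive [pl] there, and a vanishing fibre sum makes the multiple 0. *)
Lemma dual_flow_start_zero a b k q p (pl l : X -> R) (Z : eqType) (pr : X -> Z) w (e : rel X) :
  a < b -> reversible a b q p k ->
  (forall x, 0 < pl x) -> (forall x, p t x @[t --> a^'+] --> pl x) ->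
  dual_flow a b q w -> (forall x, w t x @[t --> a^'+] --> l x) ->
  (forall x y, pr x = pr y -> connect e x y) ->
  (forall x y, e x y -> x != y /\ forall b', a < b' < b ->
     ~ bounded_primitive (fun t => q t x y) a b') ->
  (forall z, \sum_(x | pr x == z) l x = 0) -> forall x, l x = 0.
Proof.
move=> ab rev pl0 ppl wd wl pre eoo suml x.
have [c c0 npc] := near_lower ppl pl0.
pose B := \sum_y `|l y| + 1.
have B0 : 0 <= B by rewrite addr_ge0// sumr_ge0.
have nwB : \forall t \near a^'+, forall y, `|w t y| <= B.
  apply: filter_forall => y; apply: (cvgr_le _ (cvg_norm (wl y))).
  by have := ler_norm_bigsum l y; rewrite /B; lra.
have [s sab pcwB] := near_right_interval ab (filterI npc nwB).
have as_ : a < s by lra.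
have rev' : reversible a s q p k by apply: reversible_sub rev; lra.
have k0 := rev_lip_ge0 rev.
have wB t y : a < t < s -> `|w t y| <= B by move=> ts; exact: (pcwB t ts).2.
have pc' t y : a < t < s -> c <= p t y by move=> ts; exact: (pcwB t ts).1.
have ah : approx_heat a s q (B * k / c ^+ 2 + 1) (fun t x => w t x / p t x).
  apply: (@dual_flow_approx _ _ a s q) => //.
  - by apply: dual_flow_sub wd; lra.
  - exact: rev_prob_lip rev'.
  - exact: rev_balance rev'.
have rB t y : a < t < s -> `|w t y / p t y| <= B / c.
  move=> ts; have := pc' t y ts => ptx.
  rewrite normrM ler_pM ?wB// normfV gtr0_norm ?lef_pV2 ?posrE//; lra.
have K0 : 0 <= B * k / c ^+ 2 + 1.
  by rewrite addr_ge0// !mulr_ge0// invr_ge0 sqr_ge0.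
have Bc0 : 0 <= B / c by rewrite divr_ge0// ltW.
have rl y : w t y / p t y @[t --> a^'+] --> l y / pl y.
  by apply: cvgM => //; apply: cvgV; [rewrite gt_eqF|exact: ppl].
have edge u v : e u v -> l u / pl u = l v / pl v.
  move=> /eoo[uv oo]; apply: (@explosive_eq a s k q p pl rev' pl0 (a^'+) _ _ _ _
    (fun y => l y / pl y) u v K0 Bc0 ppl ah rB rl uv) => P nP.
  have [b' b's b'P] := near_right_interval as_ nP.
  by exists a, b'; split=> //; [lra|lra|apply: oo; lra].
have lE y : pr y == pr x -> l y = l x / pl x * pl y.
  move=> /eqP/pre/(connect_invariant edge) <-.
  by rewrite divfK// gt_eqF.
have := suml (pr x); rewrite (eq_bigr _ lE) -mulr_sumr => /eqP.
rewrite mulf_eq0 => /orP[|/eqP S0].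
  by rewrite mulf_eq0 invr_eq0 (gt_eqF (pl0 x)) orbF => /eqP.
have : 0 < \sum_(y | pr y == pr x) pl y.
  rewrite (bigD1 x)//= ltr_pwDl// sumr_ge0// => y _; exact: ltW.
by rewrite S0 ltxx.
Qed.

End ReversibleFlow.

(** * The intervals of a singular Markov triple *)

Lemma reversibleN {R : realType} {X : finType} (a b k : R) (q : R -> X -> X -> R) p :
  reversible a b q p k ->
  reversible (- b) (- a) (fun t => q (- t)) (fun t => p (- t)) k.
Proof.
move=> [H1 H2 H3 H4 H5 H6]; split=> //.
- by move=> t x y tab; apply: H1; lra.
- move=> t x y tab xy; have tN : a < - t < b by lra.
  have c1 : - u @[u --> t] --> - t by apply: cvgN; exact: cvg_id.
  have c2 : q u x y @[u --> - t] --> q (- t) x y := H2 _ x y tN xy.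
  exact: (cvg_comp _ _ c1 c2).
- by move=> t x tab; apply: H4; lra.
- move=> s t x sab tab; have -> : `|s - t| = `|- s - - t|.
    by rewrite -normrN; congr `|_|; ring.
  by apply: H5; lra.
- by move=> t x y tab; apply: H6; lra.
Qed.

Lemma continuous_of_locally_lipschitz {R : realType} (f : R -> R) (a b t : R) :
  [locally [lipschitz (f u) | u in `]a, b[%classic]] -> a < t < b ->
  {for t, continuous f}.
Proof.
move=> fl tab.
have /(_ _)/pinfty_ex_gt0[|k k0] := fl (t, t).
  by split; rewrite /= in_itv.
move=> [[A1 A2] [/= A1t A2t] AP].
apply/cvgrPdist_le => e e0.
have ek : 0 < e / k by rewrite divr_gt0.
have tt : A2 t by apply: nbhs_singleton.
near=> u.
have uab : a < u < b by near: u; exact: near_oo.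
have A1u : A1 u by near: u.
have := AP (u, t) (conj A1u tt); rewrite /= !in_itv/= => /(_ (conj uab tab)).
rewrite distrC => /le_trans; apply.
apply: (@le_trans _ _ (k * (e / k))); last by rewrite mulrCA divff ?mulr1// gt_eqF.
rewrite ler_pM2l// distrC; near: u; exact: (@cvgr_dist_le _ _ _ _ _ id t).
Unshelve. all: by end_near. Qed.

Section Pieces.
Context {R : realType} {T : R} (M : singular_markov_triple T).

Lemma knot_le i j : (i <= j <= nsteps M)%N -> knot M i <= knot M j.
Proof.
move=> /andP[ij jn]; elim: j ij jn => [|j IH]; first by rewrite leqn0 => /eqP ->.
rewrite leq_eqVlt => /orP[/eqP -> //|ij] jn.
by apply: le_trans (IH ij (ltnW jn)) _; apply: ltW; exact: knot_lt.
Qed.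

Lemma inner_reversible i : (i < nsteps M)%N -> exists k,
  reversible (knot M i) (knot M i.+1) (fun t (x y : st M i) => rate M t x y) (prob M) k.
Proof.
move=> iN.
have mk t : knot M i < t < knot M i.+1 -> markov_triple (@rate _ _ M i t) (prob M t).
  exact: inner_markov.
have [x|x K K' KK' H s t su tu|k k0 kP] := @fin_upper_bound R (st M i) (fun x k =>
    forall s t, knot M i < s < knot M i.+1 -> knot M i < t < knot M i.+1 ->
      `|prob M s x - prob M t x| <= k * `|s - t|).
- have := prob_lipschitz x iN; rewrite /lipschitz_on => /pinfty_ex_gt0[k k0 kP].
  exists k => s t sab tab; apply: (kP (s, t)); split; rewrite /= in_itv//=.
- by apply: le_trans (H s t su tu) _; rewrite ler_wpM2r.
exists k; split=> //.
- by move=> t x y tab xy; exact: (rate_ge0 (mk t tab)).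
- move=> t x y tab xy; have [r0|[r0 rl]] := rate_regular iN xy.
    have c1 : rate M u x y @[u --> t] --> rate M t x y.
      rewrite (r0 t tab); apply: cvg_near_cst.
      by apply: filterS (near_oo tab) => u /r0.
    exact: c1.
  have lc := continuous_of_locally_lipschitz rl tab.
  have E : \forall u \near t, expR (ln (rate M u x y)) = rate M u x y.
    by apply: filterS (near_oo tab) => u /r0 ?; rewrite lnK// posrE.
  have ec := continuous_comp lc (@continuous_expR R _).
  have c1 : rate M u x y @[u --> t] --> expR (ln (rate M t x y)).
    by apply: cvg_trans ec; exact: near_eq_cvg E.
  have rt : expR (ln (rate M t x y)) = rate M t x y by rewrite lnK// posrE r0.
  by rewrite rt in c1; exact: c1.
- move=> t x tab; rewrite (prob_gt0 (mk t tab))/= -(prob_sum1 (mk t tab)).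
  by rewrite (bigD1 x)//= lerDl sumr_ge0// => y _; rewrite ltW// (prob_gt0 (mk t tab)).
- by move=> s t x sab tab; exact: kP.
- by move=> t x y tab; exact: (detailed_balance (mk t tab)).
Qed.

(** An edge with infinite limit would join its endpoints into one cluster; between clusters the
    limits are thus finite, and there are finitely many pairs. *)
Lemma finite_rate_bound (X : finType) (Z : eqType) (F : set_system R) {FF : Filter F}
    (r : R -> X -> X -> R) (l : X -> X -> \bar R) (pr : X -> Z) :
  (forall x y, x != y -> (r t x y)%:E @[t --> F] --> l x y /\ (0 <= l x y)%E) ->
  (forall x y, pr x = pr y <-> connect [rel u v | (u != v) && (l u v == +oo%E)] x y) ->
  exists2 K, 0 <= K & \forall t \near F, forall x y, pr x != pr y -> r t x y <= K.
Proof.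
move=> rl prl.
have [[x y]|[x y] K K' KK' H|K K0 KP] := @fin_upper_bound R (X * X)%type
    (fun xy K => pr xy.1 != pr xy.2 -> \forall t \near F, r t xy.1 xy.2 <= K).
- have [prxy|prxy] := eqVneq (pr x) (pr y); first by exists 0.
  have xy : x != y by apply: contraNneq prxy => ->.
  have [cv l0] := rl x y xy.
  have lfin : l x y != +oo%E.
    apply: contraNneq prxy => loo; apply/eqP/prl; apply: connect1.
    by rewrite /= xy loo eqxx.
  case: (l x y) cv l0 lfin => [u| |]// cv _ _; exists (u + 1) => _ /=.
  have [_ {}cv] := (fine_cvgP _ _).1 cv.
  by apply: (cvgr_le _ cv); lra.
- by move=> /H; apply: filterS => t /le_trans; apply.
exists K => //.
have : \forall t \near F, forall xy : X * X, pr xy.1 != pr xy.2 -> r t xy.1 xy.2 <= K.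
  apply: filter_forall => xy; have [e|e] := eqVneq (pr xy.1) (pr xy.2).
    exact: nearW.
  by apply: filterS (KP xy e) => t.
by apply: filterS => t H x y; exact: (H (x, y)).
Qed.

Section Piece.
Variables (i : nat).
Hypothesis iN : (i < nsteps M)%N.
Let a := knot M i.
Let b := knot M i.+1.
Let q t (x y : st M i) := rate M t x y.

Let ab : a < b. Proof. exact: knot_lt. Qed.

Lemma rate_c_explosive (x y : st M i) : x != y -> rate_c M x y = +oo%E ->
  forall a', a < a' < b -> ~ bounded_primitive (fun t => q t x y) a' b.
Proof.
move=> xy roo a' a'b bp; have [k rv] := inner_reversible iN.
have := rate_c_int iN xy roo a'b.
suff : (\int[@lebesgue_measure R]_(t in `]a', b[) (q t x y)%:E < +oo)%E.
  by move=> + E; rewrite E ltxx.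
apply: bounded_primitive_integral bp; first by lra.
  by move=> t tab; apply: (rev_rate_cont rv) => //; rewrite -/a -/b; lra.
by move=> t tab; apply: (rev_rate_ge0 rv) => //; rewrite -/a -/b; lra.
Qed.

(** Limits agree along explosive paths, which connect the fibres of [collapse], so they factor
    through it. *)
Lemma heat_piece_end v : heat_flow a b q v ->
  exists g : kst M i.+1 -> R, forall y : st M i, v t y @[t --> b^'-] --> g (collapse M y).
Proof.
move=> vh; have [k rv] := inner_reversible iN.
have [||g0 vg gE] := heat_flow_end ab rv (pl := prob_c M) _ _ vh.
- by move=> x; have [_ /andP[]] := prob_c_lim x iN.
- by move=> x; have [] := prob_c_lim x iN.
have /choice[pre preK] := collapse_surj iN.
exists (fun z => g0 (pre z)) => y.
suff -> : g0 (pre (collapse M y)) = g0 y by exact: vg.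
have /(collapse_eq _ _ iN) : collapse M (pre (collapse M y)) = collapse M y by exact: preK.
apply: connect_invariant => u w /= /andP[uw /eqP roo].
by apply: gE => // a' a'b; exact: rate_c_explosive.
Qed.

Lemma heat_piece_start (f : kst M i -> R) : exists v (g : kst M i.+1 -> R),
  [/\ heat_flow a b q v,
      forall x : st M i, v t x @[t --> a^'+] --> f (spawn M x) &
      forall y : st M i, v t y @[t --> b^'-] --> g (collapse M y)].
Proof.
have [k rv] := inner_reversible iN.
have [K K0 nK] := finite_rate_bound (fun x y => rate_s_lim (x := x) (y := y) iN)
  (fun x y => spawn_eq x y iN).
have [b' abb' KP] := near_right_interval ab nK.
have [||v vh va] := heat_start_exists ab rv (pr := spawn M) f _ K0 (b' := b') _.
- lra.
- by move=> t x y tab; exact: KP.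
have [g vg] := heat_piece_end vh; by exists v, g.
Qed.

Lemma heat_piece_mid s (w : st M i -> R) : a < s < b -> exists v (g : kst M i.+1 -> R),
  [/\ heat_flow a b q v,
      forall x : st M i, v s x = w x &
      forall y : st M i, v t y @[t --> b^'-] --> g (collapse M y)].
Proof.
move=> sab; have [k rv] := inner_reversible iN.
have [v vh vs] := heat_flow_exists ab rv w sab.
have [g vg] := heat_piece_end vh; by exists v, g.
Qed.

(** Here [a'] is either the knot or an initial time inside the interval. *)
Lemma heat_piece_unique a' u v : a <= a' < b ->
  heat_flow a' b q u -> heat_flow a' b q v ->
  (forall x, exists l : R, u t x @[t --> a'^'+] --> l /\ v t x @[t --> a'^'+] --> l) ->
  forall t x, a' < t < b -> u t x = v t x.
Proof.
move=> aa' uh vh uv; have [k rv] := inner_reversible iN.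
have a'b : a' < b by lra.
have rv' : reversible a' b q (prob M) k by apply: reversible_sub rv; rewrite -/a -/b; lra.
apply: (heat_flow_unique rv' uh vh) => x; have [l [ul vl]] := uv x.
by rewrite -(subrr l); exact: cvgB.
Qed.

(** The dual equation in its original time direction; reversing time turns it into [dual_flow]. *)
Definition dual_piece (a' b' : R) (w : R -> st M i -> R) := forall (t : R) x, a' < t < b' ->
  is_derive t 1 (w ^~ x) (- dual_laplacian (q t) (w t) x).

Lemma dual_pieceN a' b' w : dual_piece a' b' w ->
  dual_flow (- b') (- a') (fun t => q (- t)) (fun t => w (- t)).
Proof.
move=> wd t x tab; have tN : a' < - t < b' by lra.
have := is_derive_opp_arg (wd _ x tN) => H; by apply: is_derive_eq H _; rewrite opprK.
Qed.

Lemma dual_piece_of_flow a' b' w : dual_flow (- b') (- a') (fun t => q (- t)) w ->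
  dual_piece a' b' (fun t => w (- t)).
Proof.
move=> wd t x tab; have tN : - b' < - t < - a' by lra.
by have := is_derive_opp_arg (wd _ x tN); rewrite opprK.
Qed.

Let abN : - b < - a. Proof. by have := ab; lra. Qed.

Lemma dual_piece_end w : dual_piece a b w ->
  exists g : st M i -> R, forall x, w t x @[t --> a^'+] --> g x.
Proof.
move=> wd; have [k rv] := inner_reversible iN.
have [||g wg] := dual_flow_end abN (reversibleN rv) (pl := prob_s M) _ _ (dual_pieceN wd).
- by move=> x; have [_ /andP[]] := prob_s_lim x iN.
- by move=> x; have [/cvg_at_rightNP] := prob_s_lim x iN.
by exists g => x; apply/cvg_at_rightNP; exact: wg.
Qed.

(** The mass [g z] is split over the fibre of [z] in proportion to [prob_c], whose sum over the
    fibre is [kprob z]; hence the quotient [g z / kprob z]. *)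
Lemma dual_piece_start (g : kst M i.+1 -> R) : exists w (l m : st M i -> R),
  [/\ dual_piece a b w,
      forall y, w t y @[t --> b^'-] --> l y,
      forall z, g z = \sum_(y | collapse M y == z) l y &
      forall x, w t x @[t --> a^'+] --> m x].
Proof.
have [k rv] := inner_reversible iN; have rvN := reversibleN rv.
have pl0 x : 0 < prob_c M (x : st M i) by have [_ /andP[]] := prob_c_lim x iN.
have ppl x : prob M (- t) (x : st M i) @[t --> (- b)^'+] --> prob_c M x.
  by have [/cvg_at_leftNP] := prob_c_lim x iN.
have rN (x y : st M i) : x != y ->
    (rate M (- t) x y)%:E @[t --> (- b)^'+] --> rate_c M x y /\ (0 <= rate_c M x y)%E.
  by move=> xy; have [/cvg_at_leftNP] := rate_c_lim iN xy.
have [K K0 nK] := finite_rate_bound rN (fun x y => collapse_eq x y iN).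
have [c c0 nc] := near_lower ppl pl0.
have [b' bb' KcP] := near_right_interval abN (filterI nK nc).
have bb'a : - b < b' <= - a by lra.
have [||w0 wd wl] := dual_start_exists abN rvN (pr := collapse M)
  (fun z => g z / kprob M z) bb'a K0 c0 _ _ ppl.
- by move=> t x y tb; apply: (KcP t tb).1.
- by move=> t x tb; exact: (KcP t tb).2.
have wp := dual_piece_of_flow wd.
have [m wm] := dual_piece_end wp.
exists (fun t => w0 (- t)), (fun y => g (collapse M y) / kprob M (collapse M y) * prob_c M y), m.
split=> // [y|z].
  have E : (fun t => w0 (- t) y) \o -%R = w0 ^~ y.
    by apply/funext => t /=; rewrite opprK.
  by apply/cvg_at_leftNP; rewrite E; exact: wl.
rewrite (eq_bigr (fun y => g z / kprob M z * prob_c M y)); last by move=> y /eqP ->.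
have kz : kprob M z != 0 by rewrite gt_eqF// (prob_gt0 (knot_markov iN)).
by rewrite -mulr_sumr -kprob_c// divfK.
Qed.

Lemma dual_piece_mid s (w0 : st M i -> R) : a < s < b -> exists w (m : st M i -> R),
  [/\ dual_piece a b w,
      forall y, w s y = w0 y &
      forall x, w t x @[t --> a^'+] --> m x].
Proof.
move=> sab; have [k rv] := inner_reversible iN; have rvN := reversibleN rv.
have sN : - b < - s < - a by lra.
have [w wd ws] := dual_flow_exists abN rvN w0 sN.
have wp := dual_piece_of_flow wd.
have [m wm] := dual_piece_end wp.
by exists (fun t => w (- t)), m.
Qed.

Lemma dual_piece_unique b' u v : a < b' <= b ->
  dual_piece a b' u -> dual_piece a b' v ->
  (forall x, exists l : R, u t x @[t --> b'^'-] --> l /\ v t x @[t --> b'^'-] --> l) ->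
  forall t x, a < t < b' -> u t x = v t x.
Proof.
move=> abb' ud vd uv t x tab; have [k rv] := inner_reversible iN.
have b'a : - b' < - a by lra.
have rv' : reversible (- b') (- a) (fun t => q (- t)) (fun t => prob M (- t)) k.
  by apply: reversible_sub (reversibleN rv); rewrite -/a -/b; lra.
have tN : - b' < - t < - a by lra.
have := dual_flow_unique rv' (dual_pieceN ud) (dual_pieceN vd) _ x tN.
rewrite opprK; apply => y; have [l [ul vl]] := uv y.
rewrite -(subrr l); apply: cvgB.
  by have /cvg_at_leftNP := ul.
by have /cvg_at_leftNP := vl.
Qed.

(** Equal fibre sums imply equal limits, by [dual_flow_start_zero] for the time-reversed difference;
    the usual uniqueness then applies. *)
Lemma dual_piece_unique_knot u v (l m : st M i -> R) :
  dual_piece a b u -> dual_piece a b v ->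
  (forall y, u t y @[t --> b^'-] --> l y) -> (forall y, v t y @[t --> b^'-] --> m y) ->
  (forall z, \sum_(y | collapse M y == z) l y = \sum_(y | collapse M y == z) m y) ->
  forall t x, a < t < b -> u t x = v t x.
Proof.
move=> ud vd ul vm lm; have [k rv] := inner_reversible iN; have rvN := reversibleN rv.
apply: (@dual_piece_unique b) => //; first by have := ab; lra.
suff lmE y : l y - m y = 0.
  by move=> y; exists (l y); split=> //; have /eqP := lmE y; rewrite subr_eq0 => /eqP ->.
apply: (@dual_flow_start_zero R (st M i) (- b) (- a) k (fun t => q (- t)) (fun t => prob M (- t))
  (prob_c M) (fun y => l y - m y) (kst M i.+1) (collapse M) (fun t y => u (- t) y - v (- t) y)
  [rel u v | (u != v) && (rate_c M u v == +oo%E)]) => //.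
- by move=> x; have [_ /andP[]] := prob_c_lim x iN.
- by move=> x; have [/cvg_at_leftNP] := prob_c_lim x iN.
- exact: (dual_flowB (dual_pieceN ud) (dual_pieceN vd)).
- by move=> x; apply: cvgB; [have /cvg_at_leftNP := ul x|have /cvg_at_leftNP := vm x].
- by move=> x z /(collapse_eq _ _ iN).
- move=> x z /= /andP[xz /eqP roo]; split=> // b' b'a bp.
  have bN : a < - b' < b by lra.
  apply: (rate_c_explosive xz roo bN); apply: bounded_primitiveN.
  by rewrite opprK.
- by move=> z; rewrite sumrB lm subrr.
Qed.

End Piece.
End Pieces.

(** * Gluing along the knots *)

Lemma forward_choice (B C : nat -> Type) (P : forall i, B i -> C i -> B i.+1 -> Prop) :
  (forall i b, exists c b', P i b c b') -> forall b0, exists K V,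
  K 0%N = b0 /\ forall i, P i (K i) (V i) (K i.+1).
Proof.
move=> H b0.
have H' i (b : B i) : {cb : C i * B i.+1 | P i b cb.1 cb.2}.
  by apply: cid; have [c [b' ?]] := H i b; exists (c, b').
pose K := nat_rect B b0 (fun i b => (sval (H' i b)).2).
by exists K, (fun i => (sval (H' i (K i))).1); split=> // i; exact: (svalP (H' i (K i))).
Qed.

(** Descending recursion over dependent types, from [n] down to 0; [B0] and [C0] fill the indices
    never reached. *)
Lemma backward_choice (B C : nat -> Type) (P : forall i, B i -> C i -> B i.+1 -> Prop)
    (B0 : forall i, B i) (C0 : forall i, C i) n :
  (forall i b', exists b c, P i b c b') -> forall bn : B n, exists K V,
  K n = bn /\ forall i, (i < n)%N -> P i (K i) (V i) (K i.+1).
Proof.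
move=> H; elim: n => [|n IH] bn.
  by exists (dfwith B0 0%N bn), C0; split=> //; rewrite dfwithin.
have [b [c bc]] := H n bn; have [K [V [Kn KV]]] := IH b.
exists (dfwith K n.+1 bn), (dfwith V n c); split=> [|i]; first by rewrite dfwithin.
rewrite ltnS leq_eqVlt => /orP[/eqP ->|iN].
  by rewrite !dfwithin dfwithout ?Kn// gtn_eqF.
by rewrite !dfwithout ?gtn_eqF//; [exact: KV|exact: ltnW].
Qed.

Section ValL.
Context {R : realType} {U : Type} (A : set U).

Lemma valL_sigL (f : U -> R) p : A p -> 'valL_0 (sigL A f) p = f p.
Proof.
move=> Ap; have := congr1 (fun F => F f p) (@sigLK U R 0 A).
by rewrite /= /patch mem_set.
Qed.

Lemma valL_val (f : A -> R) (p : A) : 'valL_0 f (val p) = f p.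
Proof. exact: (congr1 (fun F => F p) (@valLK U R 0 A f)). Qed.

Lemma valL_ext (f g : A -> R) :
  (forall p, A p -> 'valL_0 f p = 'valL_0 g p) -> f = g.
Proof.
move=> fg; apply/funext => p; rewrite -(valL_val f) -(valL_val g).
by apply: fg; exact: set_valP.
Qed.

End ValL.

Section Glue.
Context {R : realType} {T : R} (M : singular_markov_triple T).

Lemma knot_ge0 i : (i <= nsteps M)%N -> 0 <= knot M i.
Proof. by move=> iN; rewrite -(knot0 M); apply: knot_le. Qed.

Lemma knot_leT i : (i <= nsteps M)%N -> knot M i <= T.
Proof.
move=> iN; apply: (@le_trans _ _ (knot M (nsteps M))); last by rewrite knotT.
by apply: knot_le; rewrite iN leqnn.
Qed.

Lemma cvg_near_eq (F : set_system R) {FF : Filter F} (f g : R -> R) (l : R) :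
  (\forall t \near F, f t = g t) -> f t @[t --> F] --> l -> g t @[t --> F] --> l.
Proof. by move=> fg fl; apply: cvg_trans fl; exact: near_eq_cvg fg. Qed.

Lemma near_oo_gt (s a t b : R) : a < t < b -> s < t ->
  \forall r \near t, [/\ a < r < b & s < r].
Proof.
move=> tab st; have mt : Num.max a s < t < b by rewrite gt_max; lra.
apply: filterS (near_oo mt) => r; rewrite gt_max => h; split; lra.
Qed.

(** * Heat equation on space-time *)

Section Heat.
Context (s : R) (psi0 : spacetime M s s -> R).
Hypothesis s0T : 0 <= s <= T.
Let u0 : st_point M -> R := 'valL_0 psi0.

(** The guards cover every position of [s] relative to the interval, so that each index admits a
    step and a single recursion from knot 0 passes through the initial time. *)
Definition heat_step i (f : kst M i -> R) (v : R -> st M i -> R) (g : kst M i.+1 -> R) : Prop :=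
  (i < nsteps M)%N ->
  [/\ s < knot M i.+1 -> heat_flow (knot M i) (knot M i.+1) (fun t x y => rate M t x y) v,
      s <= knot M i -> forall x, v t x @[t --> (knot M i)^'+] --> f (spawn M x),
      knot M i < s < knot M i.+1 -> forall x, v s x = u0 (inner s x),
      s < knot M i.+1 -> forall y, v t y @[t --> (knot M i.+1)^'-] --> g (collapse M y) &
      knot M i.+1 = s -> forall z, g z = u0 (at_knot z)].

Lemma heat_step_exists i f : exists v g, @heat_step i f v g.
Proof.
have [iN|niN] := boolP (i < nsteps M)%N; last first.
  by exists (fun _ _ => 0), (fun=> 0); rewrite /heat_step (negPf niN).
have ab := knot_lt iN.
have [sa|as_] := leP s (knot M i).
  by have [v [g [vh va vb]]] := heat_piece_start iN f; exists v, g => _; split=> //; lra.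
have [sb|bs] := ltP s (knot M i.+1).
  have [|v [g [vh vs vb]]] := heat_piece_mid iN (s := s) (fun x => u0 (inner s x)); first lra.
  by exists v, g => _; split=> //; lra.
(* Intervals ending at or before [s]: the value at the right knot is the datum if that knot is [s],
   and the default 0 of [u0] otherwise. *)
by exists (fun _ _ => 0), (fun z => u0 (at_knot z)) => _; split=> //; lra.
Qed.

Lemma heat_solution_exists : exists psi, heat_solution (T := T) psi0 psi.
Proof.
have [K [V [K0 KV]]] := forward_choice (fun i f => @heat_step_exists i f)
  (fun z : kst M 0%N => u0 (at_knot z)).
pose U (p : st_point M) : R :=
  match p with at_knot i z => K i z | inner i r x => V i r x end.
exists (sigL (spacetime M s T) U); rewrite /heat_solution.
set u := 'valL_0 _.
have uK i (z : kst M i) : (i <= nsteps M)%N -> s <= knot M i -> u (at_knot z) = K i z.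
  by move=> iN si; rewrite /u valL_sigL//=; have := knot_leT iN; split=> //; lra.
have uV i (x : st M i) t : (i < nsteps M)%N -> knot M i < t < knot M i.+1 -> s <= t ->
    u (inner t x) = V i t x.
  by move=> iN tab st; rewrite /u valL_sigL//=; have := knot_leT iN; split=> //; lra.
split.
- move=> p; rewrite -(valL_val psi0 p) -/u0; have := set_valP p.
  case: (val p) => [i z [iN sis]|i r x [iN rab srs]].
    rewrite uK//; last by lra.
    have {sis} si : knot M i = s by lra.
    (* At knot 0 the datum starts the recursion; at a later knot it is supplied by the preceding
       interval. *)
    case: i z iN si => [|i] z iN si; first by rewrite K0.
    by have [_ _ _ _ ->] := KV i iN.
  have {srs} rs : r = s by lra.
  subst r; rewrite uV//.
  by have [_ _ -> ] := KV i iN.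
- move=> i x iN sab; have [vh _ _ _ _] := KV i iN.
  rewrite uV//; have sb : s < knot M i.+1 by lra.
  apply: (cvg_near_eq (f := V i ^~ x)).
    by apply: filterS (near_right_oo sb) => r rb; rewrite uV//; lra.
  by apply: cvg_at_right_filter; apply: is_derive_continuous (vh sb s x sab).
- move=> i x t iN tab stT; have [vh _ _ _ _] := KV i iN.
  have sb : s < knot M i.+1 by lra.
  have -> : (fun y : st M i => u (inner t y)) = V i t.
    by apply/funext => y; rewrite uV//; lra.
  apply: near_eq_is_derive (vh sb t x tab).
  have st : s < t by lra.
  by apply: filterS (near_oo_gt tab st) => r [rab sr]; rewrite uV// ltW.
- move=> i z x iN sa <-; have [_ va _ _ _] := KV i iN.
  rewrite uK//; last exact: ltnW.
  apply: (cvg_near_eq (f := V i ^~ x)); last exact: va.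
  by apply: filterS (near_right_oo (knot_lt iN)) => r rb; rewrite uV//; lra.
- move=> i z y iN sb <-; have [_ _ _ vb _] := KV i iN.
  rewrite uK//; last exact: ltW.
  apply: (cvg_near_eq (f := V i ^~ y)); last exact: vb.
  have mb : Num.max (knot M i) s < knot M i.+1 by rewrite gt_max sb knot_lt.
  by apply: filterS (near_left_oo mb) => r; rewrite gt_max => rb; rewrite uV//; lra.
Qed.

Lemma heat_solution_unique psi1 psi2 :
  heat_solution (T := T) psi0 psi1 -> heat_solution psi0 psi2 -> psi1 = psi2.
Proof.
rewrite /heat_solution; set u1 := 'valL_0 psi1; set u2 := 'valL_0 psi2.
move=> [i1 c1 d1 l1 r1] [i2 c2 d2 l2 r2].
have init p : spacetime M s s p -> u1 p = u2 p.
  move=> sp; have := i1 (SigSub (mem_set sp)); have := i2 (SigSub (mem_set sp)).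
  by rewrite /= => -> ->.
have step i : (i < nsteps M)%N ->
    (s <= knot M i -> forall z : kst M i, u1 (at_knot z) = u2 (at_knot z)) ->
    forall t (x : st M i), knot M i < t < knot M i.+1 -> s <= t -> u1 (inner t x) = u2 (inner t x).
  move=> iN IH t x tab; rewrite le_eqVlt => /orP[/eqP E|st].
    by apply: init; rewrite /= -E lexx; split=> //; rewrite E.
  have bT := knot_leT iN.
  (* The time from which the equation runs on this interval; agreement there comes from the knot or
     from the initial datum. *)
  pose a' := Num.max (knot M i) s.
  have [a'1 a'2] : knot M i <= a' /\ s <= a' by rewrite !le_max !lexx orbT.
  have a'b : knot M i <= a' < knot M i.+1 by rewrite a'1 gt_max; lra.
  have a't : a' < t < knot M i.+1 by rewrite gt_max; lra.
  apply: (@heat_piece_unique _ _ M i iN a' (fun t x => u1 (inner t x))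
    (fun t x => u2 (inner t x)) a'b) => //.
  + by move=> r y ra; apply: d1 => //; lra.
  + by move=> r y ra; apply: d2 => //; lra.
  + move=> y; rewrite /a'; have [as_|sa] := ltP (knot M i) s.
      have sab : knot M i < s < knot M i.+1 by lra.
      exists (u1 (inner s y)); split; first exact: c1.
      have -> : u1 (inner s y) = u2 (inner s y).
        by apply: init; split=> //; rewrite lexx.
      exact: c2.
    exists (u1 (at_knot (spawn M y))); split; first exact: l1.
    by rewrite IH//; exact: l2.
have knots i : (i <= nsteps M)%N -> s <= knot M i ->
    forall z : kst M i, u1 (at_knot z) = u2 (at_knot z).
  elim: i => [|i IH] iN.
    move=> s0 z; apply: init; split=> //; have := knot0 M; have := s0T; lra.
  rewrite le_eqVlt => /orP[/eqP E|si] z; first by apply: init; split=> //; rewrite -E lexx.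
  (* By surjectivity every knot value is a left limit from the preceding interval. *)
  have [y yz] := collapse_surj iN z.
  have u1l := r1 i z y iN si yz; have u2l := r2 i z y iN si yz.
  apply: (cvg_unique _ u1l) => //; apply: cvg_near_eq u2l.
  have mb : Num.max (knot M i) s < knot M i.+1 by rewrite gt_max si knot_lt.
  apply: filterS (near_left_oo mb) => r; rewrite gt_max => rb.
  by apply/esym/step => //; [exact: IH (ltnW iN)|lra|lra].
apply: valL_ext => -[i z [iN sit]|i t x [iN tab stT]].
  by apply: knots => //; lra.
by apply: step => //; [exact: knots (ltnW iN)|lra].
Qed.

End Heat.

(** * Dual heat equation on space-time *)

Section Dual.
Context (t : R) (sigma0 : spacetime M t t -> R).
Hypothesis t0T : 0 <= t <= T.
Let u0 : st_point M -> R := 'valL_0 sigma0.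

(** The one-sided limits [l] and [m] are existential because the knot values record only their fibre
    sums. *)
Definition dual_step i (f : kst M i -> R) (w : R -> st M i -> R) (g : kst M i.+1 -> R) : Prop :=
  (i < nsteps M)%N ->
  [/\ knot M i < t -> dual_piece (knot M i) (knot M i.+1) w,
      knot M i.+1 <= t -> exists l : st M i -> R,
        (forall y, w r y @[r --> (knot M i.+1)^'-] --> l y) /\
        (forall z, g z = \sum_(y | collapse M y == z) l y),
      knot M i < t < knot M i.+1 -> forall x, w t x = u0 (inner t x),
      knot M i < t -> exists m : st M i -> R,
        (forall x, w r x @[r --> (knot M i)^'+] --> m x) /\
        (forall z, f z = \sum_(x | spawn M x == z) m x) &
      knot M i = t -> forall z, f z = u0 (at_knot z)].

Lemma dual_step_exists i g : exists f w, @dual_step i f w g.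
Proof.
have [iN|niN] := boolP (i < nsteps M)%N; last first.
  by exists (fun=> 0), (fun _ _ => 0); rewrite /dual_step (negPf niN).
have ab := knot_lt iN.
have [bt|tb] := leP (knot M i.+1) t.
  have [w [l [m [wd wl gl wm]]]] := dual_piece_start iN g.
  exists (fun z => \sum_(x | spawn M x == z) m x), w => _; split=> //; try lra.
    by exists l.
  by exists m.
have [at_|ta] := ltP (knot M i) t.
  have [|w [m [wd wt wm]]] := dual_piece_mid iN (s := t) (fun x => u0 (inner t x)); first lra.
  exists (fun z => \sum_(x | spawn M x == z) m x), w => _; split=> //; try lra.
  by exists m.
by exists (fun z => u0 (at_knot z)), (fun _ _ => 0) => _; split=> //; lra.
Qed.

Lemma dual_solution_exists : exists sigma, dual_heat_solution (M := M) sigma0 sigma.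
Proof.
have [K [V [KN KV]]] := backward_choice (fun i _ => 0) (fun i _ _ => 0)
  (fun i g => @dual_step_exists i g) (fun z : kst M (nsteps M) => u0 (at_knot z)).
pose U (p : st_point M) : R :=
  match p with at_knot i z => K i z | inner i r x => V i r x end.
exists (sigL (spacetime M 0 t) U); rewrite /dual_heat_solution.
set u := 'valL_0 _.
have uK i (z : kst M i) : (i <= nsteps M)%N -> knot M i <= t -> u (at_knot z) = K i z.
  by move=> iN it; rewrite /u valL_sigL//=; have := knot_ge0 iN; split=> //; lra.
have uV i (x : st M i) r : (i < nsteps M)%N -> knot M i < r < knot M i.+1 -> r <= t ->
    u (inner r x) = V i r x.
  move=> iN rab rt; rewrite /u valL_sigL//=.
  by have := knot_ge0 (ltnW iN); split=> //; lra.
split.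
- move=> p; rewrite -(valL_val sigma0 p) -/u0; have := set_valP p.
  case: (val p) => [i z [iN tit]|i r x [iN rab trt]].
    rewrite uK//; last by lra.
    have {tit} it : knot M i = t by lra.
    (* The last knot carries the starting value of the backward recursion; every other knot is the
       left end of an interval. *)
    move: (iN); rewrite leq_eqVlt => /orP[/eqP E|iN'].
      by subst i; rewrite KN.
    by have [_ _ _ _ ->] := KV i iN' iN'.
  have {trt} rt : r = t by lra.
  subst r; rewrite uV//.
  by have [_ _ -> ] := KV i iN iN.
- move=> i x iN tab; have at_ : knot M i < t by lra.
  have [wd _ _ _ _] := KV i iN iN.
  rewrite uV//; apply: (cvg_near_eq (f := V i ^~ x)).
    by apply: filterS (near_left_oo at_) => r rb; rewrite uV//; lra.
  by apply: cvg_at_left_filter; apply: is_derive_continuous (wd at_ t x tab).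
- move=> i x r iN rab rt; have at_ : knot M i < t by lra.
  have [wd _ _ _ _] := KV i iN iN.
  have -> : (fun y : st M i => u (inner r y)) = V i r.
    by apply/funext => y; rewrite uV//; lra.
  apply: near_eq_is_derive (wd at_ r x rab).
  have rm : knot M i < r < Num.min (knot M i.+1) t by rewrite lt_min; lra.
  by apply: filterS (near_oo rm) => q; rewrite lt_min => qr; rewrite uV//; lra.
- move=> i z iN at_; have [_ _ _ /(_ at_)[m [wm fm]] _] := KV i iN iN.
  have um (x : st M i) : u (inner r x) @[r --> (knot M i)^'+] --> m x.
    apply: (cvg_near_eq (f := V i ^~ x)); last exact: wm.
    have am : knot M i < Num.min (knot M i.+1) t by rewrite lt_min at_ knot_lt.
    by apply: filterS (near_right_oo am) => q; rewrite lt_min => qr; rewrite uV//; lra.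
  split=> [x _|]; first exact: cvgP (um x).
  have -> : u (at_knot z) = K i z by apply: uK; [exact: ltnW|exact: ltW].
  rewrite fm; apply: eq_bigr => x _; apply/esym/cvg_lim => //; exact: um.
- move=> i z iN bt; have [_ /(_ bt)[l [wl gl]] _ _ _] := KV i iN iN.
  have ul (y : st M i) : u (inner r y) @[r --> (knot M i.+1)^'-] --> l y.
    apply: (cvg_near_eq (f := V i ^~ y)); last exact: wl.
    by apply: filterS (near_left_oo (knot_lt iN)) => q qr; rewrite uV//; lra.
  split=> [y _|]; first exact: cvgP (ul y).
  by rewrite uK// gl; apply: eq_bigr => y _; apply/esym/cvg_lim => //; exact: ul.
Qed.

Lemma dual_solution_unique sigma1 sigma2 :
  dual_heat_solution (M := M) sigma0 sigma1 -> dual_heat_solution sigma0 sigma2 ->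
  sigma1 = sigma2.
Proof.
rewrite /dual_heat_solution; set u1 := 'valL_0 sigma1; set u2 := 'valL_0 sigma2.
move=> [i1 c1 d1 l1 r1] [i2 c2 d2 l2 r2].
have init p : spacetime M t t p -> u1 p = u2 p.
  move=> tp; have := i1 (SigSub (mem_set tp)); have := i2 (SigSub (mem_set tp)).
  by rewrite /= => -> ->.
have step i : (i < nsteps M)%N ->
    (knot M i.+1 <= t -> forall z : kst M i.+1, u1 (at_knot z) = u2 (at_knot z)) ->
    forall r (x : st M i), knot M i < r < knot M i.+1 -> r <= t ->
      u1 (inner r x) = u2 (inner r x).
  move=> iN IH r x rab; rewrite le_eqVlt => /orP[/eqP E|rt].
    by apply: init; rewrite /= E lexx; split=> //; rewrite -E.
  have a0 := knot_ge0 (ltnW iN).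
  (* If the right knot is at most [t], only fibre sums are known to agree there; otherwise the
     interval is entered at the interior time [t] with equal values. *)
  have [bt|tb] := leP (knot M i.+1) t.
    have h1 (y : st M i) : u1 (inner r y) @[r --> (knot M i.+1)^'-] -->
        lim (u1 (inner r y) @[r --> (knot M i.+1)^'-]).
      by have [cv _] := r1 i (collapse M y) iN bt; exact: cv.
    have h2 (y : st M i) : u2 (inner r y) @[r --> (knot M i.+1)^'-] -->
        lim (u2 (inner r y) @[r --> (knot M i.+1)^'-]).
      by have [cv _] := r2 i (collapse M y) iN bt; exact: cv.
    apply: (@dual_piece_unique_knot _ _ M i iN (fun r x => u1 (inner r x))
      (fun r x => u2 (inner r x)) _ _ _ _ h1 h2) => //.
    + by move=> q y qab; apply: d1 => //; lra.
    + by move=> q y qab; apply: d2 => //; lra.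
    + move=> z; have [_ <-] := r1 i z iN bt; have [_ <-] := r2 i z iN bt.
      exact: IH.
  have tab : knot M i < t <= knot M i.+1 by lra.
  have tab' : knot M i < t < knot M i.+1 by lra.
  apply: (@dual_piece_unique _ _ M i iN t (fun r x => u1 (inner r x))
    (fun r x => u2 (inner r x)) tab) => //; last by lra.
  + by move=> q y qab; apply: d1 => //; lra.
  + by move=> q y qab; apply: d2 => //; lra.
  + move=> y; exists (u1 (inner t y)); split; first exact: c1.
    have -> : u1 (inner t y) = u2 (inner t y).
      by apply: init; split=> //; rewrite lexx.
    exact: c2.
(* Induction on the number [d] of intervals left up to the last knot, since information travels
   backwards. *)
have knots d : forall i, (i + d = nsteps M)%N -> knot M i <= t ->
    forall z : kst M i, u1 (at_knot z) = u2 (at_knot z).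
  elim: d => [|d IH] i iN it z.
    apply: init; rewrite addn0 in iN; split; first by rewrite iN.
    by have := knotT M; have := t0T; rewrite -iN; lra.
  have iN' : (i < nsteps M)%N by rewrite -iN -addSnnS leq_addr.
  move: it; rewrite le_eqVlt => /orP[/eqP E|it].
    by apply: init; split; [exact: ltnW|rewrite E lexx].
  have [cv1 ->] := l1 i z iN' it; have [cv2 ->] := l2 i z iN' it.
  apply: eq_bigr => x /eqP xz; apply/esym/cvg_lim => //.
  apply: cvg_near_eq (cv1 x xz).
  have am : knot M i < Num.min (knot M i.+1) t by rewrite lt_min it knot_lt.
  apply: filterS (near_right_oo am) => q; rewrite lt_min => qr.
  by apply: step => //; [apply: IH; rewrite -iN addSnnS|lra|lra].
have knots' i : (i <= nsteps M)%N -> knot M i <= t ->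
    forall z : kst M i, u1 (at_knot z) = u2 (at_knot z).
  by move=> iN; apply: (knots (nsteps M - i)%N); rewrite subnKC.
apply: valL_ext => -[i z [iN sit]|i r x [iN rab rt]].
  by apply: knots' => //; lra.
by apply: step => //; [exact: knots'|lra].
Qed.

End Dual.
End Glue.

Theorem theorem1p1 (R : realType) (T : R) (M : singular_markov_triple T) :
  (forall s : R, 0 <= s <= T -> forall psi0 : spacetime M s s -> R,
     exists! psi : spacetime M s T -> R, heat_solution psi0 psi) /\
  (forall t : R, 0 <= t <= T -> forall sigma0 : spacetime M t t -> R,
     exists! sigma : spacetime M 0 t -> R, dual_heat_solution sigma0 sigma).
Proof.
split=> [s s0T psi0|t t0T sigma0].
  have [psi psiP] := heat_solution_exists (T := T) (M := M) psi0.
  by exists psi; split=> // psi' psi'P; exact: (heat_solution_unique s0T psiP psi'P).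
have [sigma sigmaP] := dual_solution_exists (T := T) (M := M) sigma0.
by exists sigma; split=> // sigma' sigma'P; exact: (dual_solution_unique t0T sigmaP sigma'P).
Qed.
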